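(* Let $\{R_k\}_{k=1}^\infty$ be a sequence of $d\times d$ expansive matrices with integer entries, and let $\{B_k\}_{k=1}^\infty$ and $\{B'_k\}_{k=1}^\infty$ be two sequences of finite subsets of $\mathbb{Z}^d$ with $\#B_k\ge2$ and $\#B'_k\ge2$ for all $k\ge1$. Suppose that $\{B_k\}_{k=1}^\infty$ and $\{B'_k\}_{k=1}^\infty$ are equivalent. Then the infinite convolution $\mu$ of $\{(R_k,B_k)\}_{k=1}^\infty$ exists if and only if the infinite convolution $\mu'$ of $\{(R_k,B'_k)\}_{k=1}^\infty$ exists. Moreover, if $\mu$ exists, then $\mu$ is an equi-positive measure if and only if $\mu'$ is an equi-positive measure.
   Context: A matrix is expansive if all its eigenvalues have modulus strictly greater than $1$. $\#$ denotes cardinality. For a finite nonempty set $A\subseteq\mathbb{R}^d$, $\delta_A=\frac{1}{\#A}\sum_{a\in A}\delta_a$, where $\delta_a$ is the Dirac measure at $a$; $*$ denotes convolution. Two sequences of finite sets $\{A_k\}_{k=1}^\infty$ and $\{A'_k\}_{k=1}^\infty$ in $\mathbb{R}^d$ are equivalent if $$\sum_{k=1}^{\infty}\Big(\frac{\#(A'_k\setminus A_k)}{\#A'_k}+\frac{\#(A_k\setminus A'_k)}{\#A_k}\Big)<\infty.$$ The infinite convolution of $\{(R_k,B_k)\}_{k=1}^\infty$ exists if the measures $\mu_k=\delta_{R_1^{-1}B_1}*\delta_{(R_2R_1)^{-1}B_2}*\cdots*\delta_{(R_kR_{k-1}\cdots R_1)^{-1}B_k}$ converge weakly, as $k\to\infty$,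 to a Borel probability measure $\mu$; $\mu$ is then called the infinite convolution of $\{(R_k,B_k)\}_{k=1}^\infty$. In that case, for each $k\ge1$, put $$\nu_{>k}=\delta_{R_{k+1}^{-1}B_{k+1}}*\delta_{(R_{k+2}R_{k+1})^{-1}B_{k+2}}*\cdots,$$ the infinite convolution of the shifted sequence $\{(R_{k+j},B_{k+j})\}_{j=1}^\infty$. The Fourier transform of a Borel probability measure $\eta$ on $\mathbb{R}^d$ is $\hat\eta(\xi)=\int_{\mathbb{R}^d}e^{-2\pi i\xi\cdot x}\,d\eta(x)$. A set $\Phi$ of Borel probability measures on $\mathbb{R}^d$ is an equi-positive family if there exist $\epsilon_0>0$ and $\delta_0>0$ such that for all $x\in[-\frac12,\frac12)^d$ and $\eta\in\Phi$ there exists $k_{x,\eta}\in\mathbb{Z}^d$ with $|\hat\eta(x+y+k_{x,\eta})|\ge\epsilon_0$ for all $y\in\mathbb{R}^d$ with $|y|<\delta_0$, where $k_{x,\eta}=0$ for $x=0$. The infinite convolution $\mu$ of $\{(R_k,B_k)\}_{k=1}^\infty$ is called an equi-positive measure if there is a subsequence $\{\nu_{>n_j}\}_{j=1}^\infty$ of $\{\nu_{>k}\}_{k=1}^\infty$ that forms an equi-positive family; likewise for $\mu'$, with $B'_k$ in place of $B_k$. *)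

(* Defs.v *)
From HB Require Import structures.
From mathcomp Require Import all_boot all_order all_algebra.
From mathcomp Require Import finmap complex.
From mathcomp Require Import all_classical all_reals all_analysis giry.

Set Implicit Arguments.
Unset Strict Implicit.
Unset Printing Implicit Defensive.

Import Order.TTheory GRing.Theory Num.Theory.
Import numFieldNormedType.Exports.

Local Open Scope classical_set_scope.
Local Open Scope ring_scope.

(* Sequences (R_k)_{k >= 1}, (B_k)_{k >= 1} are represented by functions on nat
   whose value at i is the term of index k = i + 1. *)

Definition expansive (R : realType) (d : nat) (A : 'M[int]_d) : Prop :=
  forall l : R[i],
    eigenvalue (map_mx (intmul (1 : R[i])) A) l -> 1 < `|l|.

Definition equivalent_seq (R : realType) (K : choiceType)
    (A A' : nat -> {fset K}) : Prop :=
  (\sum_(0 <= k <oo)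
     ((#|` (A' k `\` A k)%fset |%:R / #|` A' k |%:R +
       #|` (A k `\` A' k)%fset |%:R / #|` A k |%:R : R)%:E) < +oo)%E.

(* R^d (column vectors) with its Borel sigma-algebra *)
Definition euclid (R : realType) (d : nat) :=
  g_sigma_algebraType [set U : set 'cV[R]_d | open U].

Section BorelAddition.
Variables (R : realType) (d : nat).
Local Notation V := 'cV[R]_d.
Local Notation E := (euclid R d).

Let rball (q : 'cV[rat]_d) (n : nat) : set V :=
  ball (map_mx ratr q : V) n.+1%:R^-1.

Lemma rational_approx (x : V) (e : R) : 0 < e ->
  exists q : 'cV[rat]_d, ball (map_mx ratr q : V) e x.
Proof.
move=> e0.
have H (i : 'I_d) : {q : rat | `|x i 0 - ratr q| < e}.
  apply: cid; have xe : x i 0 - e < x i 0 + e.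
    by rewrite ltrBlDr -addrA ltrDl addr_gt0.
  have [q] := rat_in_itvoo xe.
  by rewrite in_itv/= -ltr_distlC => ?; exists q.
exists (\col_i sval (H i)); split => // i j.
rewrite !mxE !ord1 /ball/= distrC; exact: svalP (H i).
Qed.

Lemma open_prod_measurable (W : set (V * V)) :
  open W -> measurable (W : set (E * E)).
Proof.
move=> oW.
pose P (c : 'cV[rat]_d * 'cV[rat]_d * nat) :=
  (rball c.1.1 c.2 `*` rball c.1.2 c.2 : set (V * V)).
have -> : W = \bigcup_(c in [set c | P c `<=` W]) P c.
  apply/seteqP; split => [[u v] Wuv|x [c]]; last exact.
  have /nbhs_ballP[e /= e0 eW] : nbhs (u, v) W by exact: open_nbhs_nbhs.
  have [n] := ltr_add_invr (divr_gt0 e0 (ltr0n R 2)); rewrite add0r => ne.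
  have n0 : 0 < n.+1%:R^-1 :> R by rewrite invr_gt0.
  have [qu hu] := rational_approx u n0.
  have [qv hv] := rational_approx v n0.
  exists (qu, qv, n) => //= -[a b] [/= ha hb]; apply: eW; split => /=.
    apply: (@le_ball _ _ u (n.+1%:R^-1 + n.+1%:R^-1)).
      by rewrite [e]splitr lerD // ltW.
    by apply: ball_triangle ha; exact: ball_sym.
  apply: (@le_ball _ _ v (n.+1%:R^-1 + n.+1%:R^-1)).
    by rewrite [e]splitr lerD // ltW.
  by apply: ball_triangle hb; exact: ball_sym.
rewrite bigcup_mkcond; apply: countable_bigcupT_measurable => [|[[a b] n]].
  exact: countableP.
case: ifP => _; last exact: measurable0.
by apply: measurableX; apply: sub_sigma_algebra; exact: ball_open.
Qed.

Definition addE (p : E * E) : E := (p.1 : V) + (p.2 : V).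

Lemma measurable_addE : measurable_fun [set: E * E] addE.
Proof.
apply: (@measurability _ _ (E * E)%type E setT addE [set U : set V | open U]) => // _ [U oU <-].
rewrite setTI; apply: open_prod_measurable.
have /continuousP : continuous (fun p : V * V => p.1 + p.2).
  exact: add_continuous.
exact.
Qed.

End BorelAddition.

Section InfiniteConvolution.
Variables (R : realType) (d : nat).
Local Notation V := 'cV[R]_d.
Local Notation E := (euclid R d).

(* delta_A; a probability measure when A is nonempty, and 0 when A is empty *)
Definition delta_measure (A : {fset V}) : set E -> \bar R :=
  mscale (#|` A |%:R^-1 : R)%:nng
         (msum (fun i : nat => \d_(nth (0 : V) A i : E)) #|` A |).

HB.instance Definition _ (A : {fset V}) := Measure.on (delta_measure A).

Lemma delta_measureE (A : {fset V}) (U : set E) :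
  delta_measure A U =
  ((#|` A |%:R^-1)%:E * \sum_(a <- A) \d_(a : E) U)%E.
Proof.
rewrite /delta_measure /mscale /msum /=; congr (_ * _)%E.
by rewrite (big_nth (0 : V)) big_mkord.
Qed.

Lemma delta_measure_setT (A : {fset V}) : (delta_measure A setT <= 1)%E.
Proof.
rewrite delta_measureE; under eq_bigr do rewrite diracT.
rewrite big_tnth sumEFin sumr_const card_ord -EFinM lee_fin.
have [->|A0] := eqVneq (size A) 0%N; first by rewrite mulr0n mulr0.
by rewrite mulVf // pnatr_eq0.
Qed.

HB.instance Definition _ (A : {fset V}) := Measure_isSubProbability.Build _ _ _
  (delta_measure A) (delta_measure_setT A).

(* the image of the product measure under (x, y) |-> x + y *)
Definition convolution (m1 m2 : subprobability E R) : subprobability E R :=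
  giry_map (@measurable_addE R d) (product_subprobability (m1, m2)).

Definition cvg_weak (m : nat -> subprobability E R) (mu : probability E R) :=
  forall f : V -> R, continuous f -> (exists M, forall x, `|f x| <= M) ->
    (\int[m n]_x f x)%R @[n --> \oo] --> (\int[mu]_x f x)%R.

(* mxprod M i = M_{i+1} M_i ... M_1 *)
Fixpoint mxprod (M : nat -> 'M[int]_d) (i : nat) : 'M[int]_d :=
  if i is j.+1 then M i *m mxprod M j else M 0%N.

Definition inv_image (A : 'M[int]_d) (B : {fset 'cV[int]_d}) : {fset V} :=
  [fset invmx (map_mx intr A) *m map_mx intr b | b in B]%fset.

(* the measure mu_{i+1} of the partial convolutions *)
Fixpoint partial_convolution (M : nat -> 'M[int]_d)
    (B : nat -> {fset 'cV[int]_d}) (i : nat) : subprobability E R :=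
  if i is j.+1 then
    convolution (partial_convolution M B j)
                (delta_measure (inv_image (mxprod M i) (B i)))
  else delta_measure (inv_image (mxprod M 0) (B 0%N)).

Definition is_infinite_convolution (M : nat -> 'M[int]_d)
    (B : nat -> {fset 'cV[int]_d}) (mu : probability E R) : Prop :=
  cvg_weak (partial_convolution M B) mu.

Definition dotmul (x y : V) : R := \sum_i x i 0 * y i 0.

Definition enorm (x : V) : R := Num.sqrt (\sum_i x i 0 ^+ 2).

(* the integral of exp(-2 i pi <xi, x>), by real and imaginary parts *)
Definition fourier (mu : probability E R) (xi : V) : R[i] :=
  ((\int[mu]_x cos (- (2 * pi * dotmul xi x)))%R +i*
   (\int[mu]_x sin (- (2 * pi * dotmul xi x)))%R)%C.

Definition equi_positive_family (Phi : set (probability E R)) : Prop :=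
  exists eps0 delta0 : R, [/\ 0 < eps0, 0 < delta0 &
    forall x : V, (forall i, - 2^-1 <= x i 0 < 2^-1) ->
    forall eta, Phi eta ->
    exists k : 'cV[int]_d, (x = 0 -> k = 0) /\
      forall y : V, enorm y < delta0 ->
        (eps0%:C)%C <= `|fourier eta (x + y + map_mx intr k)| ].

Definition shift (T : Type) (k : nat) (u : nat -> T) : nat -> T :=
  fun i => u (k + i)%N.

(* nu j is nu_{> n j}, the infinite convolution of the sequence shifted by n j *)
Definition equi_positive_measure (M : nat -> 'M[int]_d)
    (B : nat -> {fset 'cV[int]_d}) (mu : probability E R) : Prop :=
  is_infinite_convolution M B mu /\
  exists (n : nat -> nat) (nu : nat -> probability E R),
    [/\ {homo n : i j / (i < j)%N}, forall j, (1 <= n j)%N,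
        forall j, is_infinite_convolution (shift (n j) M) (shift (n j) B) (nu j)
      & equi_positive_family (range nu)].

End InfiniteConvolution.

(* Main.v *)
(* Convolution with delta_A acts on test functions as the averaging operator
   f |-> (x |-> mean of f (x + a), a in A).  These operators commute and are
   contractions, so the partial convolutions of (B_k) and (B'_k) over indices
   k > m differ, in total variation, by at most the tail of the series that
   expresses the equivalence.

   If mu exists then so does every tail delta_{m+1} * delta_{m+2} * ...:  its
   partial convolutions are dominated by a multiple of a translate of those of
   mu, so their limits along ultrafilters are measures, and these limits agree
   because a finitely supported measure on a lattice can be cancelled from a
   convolution (Kronecker substitution reduces this to Z, where a nonzero
   linear recurrence has no nonzero solution vanishing at both infinities).
   Hence the integrals against mu'_n form Cauchy sequences, and the limit
   functional, being uniformly close to measures, is a measure.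

   For shifted sequences this gives nu'_{>n}, whose Fourier transform is
   uniformly close to that of nu_{>n}; the constant epsilon_0 is halved. *)

From HB Require Import structures.
Require Import Defs.
From mathcomp Require Import all_boot all_order all_algebra.
From mathcomp Require Import finmap complex.
From mathcomp Require Import all_classical all_reals all_analysis.
From mathcomp Require Import measurable_realfun giry.
From mathcomp Require Import lra zify.

Set Implicit Arguments.
Unset Strict Implicit.
Unset Printing Implicit Defensive.

Import Order.TTheory GRing.Theory Num.Theory.
Import numFieldNormedType.Exports.

Local Open Scope classical_set_scope.
Local Open Scope ring_scope.

(** * Integrals of bounded measurable functions *)

Section BoundedMeasurable.
Context d (T : measurableType d) (R : realType).
Implicit Types (f g : T -> R) (m : {finite_measure set T -> \bar R}).

(** On a noncompact space a positive normalized functional on bounded continuous functions need not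
    be a measure, since mass can escape to infinity. The criterion used in place of tightness is
    domination: for every [e], some finite measure bounds the functional up to [e] on functions at
    most 1, through their positive parts. It serves both the ultrafilter limits and the limit
    functional for (B'_k).

    Comparing the two sequences of partial convolutions from the first index on bounds their
    distance only by the whole series, which proves no convergence. Hence a hybrid: factors of B' up
    to index m, factors of B beyond. Its distance to mu'_n is a tail of the series, but its
    convergence requires the tail of mu to exist, and this is the real obstacle: the Fourier
    transform of delta_A may have zeros, so the tail cannot be obtained by division. Cancellation
    rests instead on finiteness of the measures: the difference of two solutions, read along lattice
    translates, tends to 0 at both ends. *)

Definition bounded_measurable f :=
  measurable_fun setT f /\ exists M : R, forall x, `|f x| <= M.

Lemma bounded_measurable_integrable m f :
  bounded_measurable f -> m.-integrable setT (EFin \o f).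
Proof.
move=> [mf [M fM]]; apply: measurable_bounded_integrable => //.
  by rewrite -ge0_fin_numE// fin_num_measure.
exists M; split; first exact: num_real.
by move=> N MN x _; exact: le_trans (fM x) (ltW MN).
Qed.

Lemma bounded_measurable_cst (c : R) : bounded_measurable (fun _ => c).
Proof. by split => //; exists `|c|. Qed.

Lemma bounded_measurableD f g : bounded_measurable f -> bounded_measurable g ->
  bounded_measurable (fun x => f x + g x).
Proof.
move=> [mf [M fM]] [mg [N gN]]; split; first exact: measurable_funD.
by exists (M + N) => x; rewrite (le_trans (ler_normD _ _))// lerD.
Qed.

Lemma bounded_measurableN f : bounded_measurable f ->
  bounded_measurable (fun x => - f x).
Proof.
move=> [mf [M fM]]; split; first exact: measurableT_comp.
by exists M => x; rewrite normrN.
Qed.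

Lemma bounded_measurableB f g : bounded_measurable f -> bounded_measurable g ->
  bounded_measurable (fun x => f x - g x).
Proof.
by move=> bf bg; apply: bounded_measurableD => //; exact: bounded_measurableN.
Qed.

Lemma bounded_measurableM f g : bounded_measurable f -> bounded_measurable g ->
  bounded_measurable (fun x => f x * g x).
Proof.
move=> [mf [M fM]] [mg [N gN]]; split; first exact: measurable_funM.
by exists (M * N) => x; rewrite normrM ler_pM.
Qed.

Lemma bounded_measurable_norm f : bounded_measurable f ->
  bounded_measurable (fun x => `|f x|).
Proof.
move=> [mf [M fM]]; split; first exact: measurableT_comp.
by exists M => x; rewrite normr_id.
Qed.

Lemma bounded_measurable_indic (A : set T) : measurable A ->
  bounded_measurable (\1_A : T -> R).
Proof.
move=> mA; split; first exact: measurable_indic.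
by exists 1 => x; rewrite indicE ger0_norm// lern1 leq_b1.
Qed.

Lemma bounded_measurable_max f g : bounded_measurable f ->
  bounded_measurable g -> bounded_measurable (fun x => Num.max (f x) (g x)).
Proof.
move=> [mf [M fM]] [mg [N gN]]; split; first exact: measurable_maxr.
by exists (Num.max M N) => x; rewrite le_max; case: (leP (f x) (g x)) => _;
  rewrite ?fM ?gN ?orbT.
Qed.

Lemma bounded_measurable_sum (I : Type) (s : seq I) (F : I -> T -> R) :
  (forall i, bounded_measurable (F i)) ->
  bounded_measurable (fun x => \sum_(i <- s) F i x).
Proof.
move=> bF; elim: s => [|i s ih].
  under eq_fun do rewrite big_nil; exact: bounded_measurable_cst.
under eq_fun do rewrite big_cons; exact: bounded_measurableD.
Qed.

Lemma Rintegral_bmD m f g : bounded_measurable f -> bounded_measurable g ->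
  (\int[m]_x (f x + g x) = \int[m]_x f x + \int[m]_x g x)%R.
Proof. by move=> *; apply: RintegralD => //; exact: bounded_measurable_integrable. Qed.

Lemma Rintegral_bmB m f g : bounded_measurable f -> bounded_measurable g ->
  (\int[m]_x (f x - g x) = \int[m]_x f x - \int[m]_x g x)%R.
Proof. by move=> *; apply: RintegralB => //; exact: bounded_measurable_integrable. Qed.

Lemma Rintegral_bmZ m f (c : R) : bounded_measurable f ->
  (\int[m]_x (c * f x) = c * \int[m]_x f x)%R.
Proof. by move=> *; apply: RintegralZl => //; exact: bounded_measurable_integrable. Qed.

Lemma Rintegral_bm_le m f g : bounded_measurable f -> bounded_measurable g ->
  (forall x, f x <= g x) -> (\int[m]_x f x <= \int[m]_x g x)%R.
Proof. by move=> *; apply: le_Rintegral => //; exact: bounded_measurable_integrable. Qed.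

Lemma Rintegral_bm_sum m (I : Type) (s : seq I) (F : I -> T -> R) :
  (forall i, bounded_measurable (F i)) ->
  (\int[m]_x (\sum_(i <- s) F i x) = \sum_(i <- s) \int[m]_x F i x)%R.
Proof.
move=> bF; elim: s => [|i s ih].
  by under eq_Rintegral do rewrite big_nil; rewrite big_nil Rintegral_cst// mul0r.
under eq_Rintegral do rewrite big_cons.
by rewrite big_cons -ih Rintegral_bmD//; exact: bounded_measurable_sum.
Qed.

Lemma Rintegral_indicT m (A : set T) : measurable A ->
  (\int[m]_x (\1_A x : R))%R = fine (m A).
Proof. by move=> mA; rewrite /Rintegral integral_indic// setIT. Qed.

End BoundedMeasurable.

(** * Approximation of indicator functions by continuous functions *)

Lemma fine_measure_small d (T : measurableType d) (R : realType)
    (m : {finite_measure set T -> \bar R}) (F : (set T)^nat) (e : R) :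
  (forall k, measurable (F k)) -> nonincreasing_seq F -> \bigcap_k F k = set0 ->
  0 < e -> exists k, fine (m (F k)) < e.
Proof.
move=> mF niF F0 e0.
have : m \o F @ \oo --> m (\bigcap_n F n).
  apply: nonincreasing_cvg_mu => //; last by rewrite F0.
  by rewrite -ge0_fin_numE// fin_num_measure.
rewrite F0 measure0 => /fine_cvgP[_] /cvgr0Pnorm_lt /(_ e e0)[k _ /(_ k)].
by rewrite /= leqnn => /(_ isT); rewrite ger0_norm ?fine_ge0//; exists k.
Qed.

Section Approximation.
Variables (R : realType) (d : nat).
Local Notation V := 'cV[R]_d.
Local Notation E := (euclid R d).

Definition bounded_continuous (f : V -> R) :=
  continuous f /\ exists M : R, forall x, `|f x| <= M.

Definition unit_continuous (f : V -> R) :=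
  continuous f /\ forall x, 0 <= f x <= 1.

Lemma open_measurable_euclid (U : set V) : open U -> measurable (U : set E).
Proof. by move=> oU; exact: sub_sigma_algebra. Qed.

Lemma continuous_measurable_euclid (f : V -> R) :
  continuous f -> measurable_fun [set: E] f.
Proof.
move=> /continuousP cf; apply: (measurability _ (RGenOpens.measurableE R)).
move=> _ [_ [a [b ->] <-]]; rewrite setTI.
by apply: open_measurable_euclid; apply: cf; exact: interval_open.
Qed.

Lemma bounded_continuous_measurable (f : V -> R) :
  bounded_continuous f -> bounded_measurable (f : E -> R).
Proof. by move=> [cf bf]; split => //; exact: continuous_measurable_euclid. Qed.

Lemma unit_continuous_bounded (f : V -> R) :
  unit_continuous f -> bounded_continuous f.
Proof.
move=> [cf f01]; split => //; exists 1 => x.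
by have /andP[f0 f1] := f01 x; rewrite ger0_norm.
Qed.

Lemma unit_continuous_measurable (f : V -> R) :
  unit_continuous f -> bounded_measurable (f : E -> R).
Proof. by move=> /unit_continuous_bounded/bounded_continuous_measurable. Qed.

Section Density.
Variable m : {finite_measure set E -> \bar R}.

(** The sets whose indicator is a limit in [L^1(m)] of continuous functions with values in [0, 1]
    include the open sets and form a sigma-algebra, hence exhaust the Borel sets. *)
Let approximable (A : set E) := measurable A /\ forall e : R, 0 < e ->
  exists g, unit_continuous g /\ \int[m]_x `|g x - \1_A x| <= e.

Let norm_indicB_measurable (g : V -> R) (A : set E) :
  unit_continuous g -> measurable A ->
  bounded_measurable (fun x : E => `|g x - \1_A x|).
Proof.
move=> ug mA; apply/bounded_measurable_norm/bounded_measurableB.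
  exact: unit_continuous_measurable.
exact: bounded_measurable_indic.
Qed.

Let approximable_open (U : set V) : open U -> approximable U.
Proof.
move=> oU; split=> [|e e0]; first exact: open_measurable_euclid.
(* [C k] is a shrinking neighbourhood of the complement of [U]. A Urysohn function equal to 0 off
   [U] and to 1 off [C k] differs from the indicator of [U] only on the intersection of [U] and
   [C k], and these intersections decrease to the empty set. *)
pose C k : set V := \bigcup_(y in ~` U) ball y k.+1%:R^-1.
have oC k : open (C k) by apply: bigcup_open => y _; exact: ball_open.
have niF : nonincreasing_seq (fun k => U `&` C k : set E).
  move=> k l kl; apply/subsetPset => x [Ux [y Uy yx]]; split => //.
  exists y => //; apply: le_ball yx.
  by rewrite lef_pV2 ?posrE ?ltr0n// ler_nat.
have F0 : \bigcap_k (U `&` C k) = set0.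
  rewrite -subset0 => x F; have [Ux _] := F 0%N I.
  have /nbhs_ballP[r /= r0 rU] : nbhs x U by exact: open_nbhs_nbhs.
  have [k] := ltr_add_invr r0; rewrite add0r => kr.
  have [_ [y Uy yx]] := F k I; apply: Uy; apply: rU.
  by apply: le_ball (ball_sym yx); exact: ltW.
have [|k mk] := fine_measure_small m _ niF F0 e0.
  by move=> k; apply: open_measurable_euclid; exact: openI.
have sep : uniform_separator (~` U) (~` C k).
  apply: uniform_separatorW.
  exists [set xy : V * V | ball xy.1 k.+1%:R^-1 xy.2].
    by rewrite -entourage_ballE; exists k.+1%:R^-1 => //=; rewrite invr_gt0.
  rewrite -subset0 => -[x y] /= [[Ux Cy] xy]; apply: Cy.
  by exists x.
pose g := Urysohn (~` U) (~` C k) : V -> R.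
have ug : unit_continuous g.
  split; first exact: Urysohn_continuous.
  by move=> x; have := @Urysohn_range V R (~` U) (~` C k) (g x);
    rewrite /= in_itv/=; apply; exists x.
exists g; split=> //.
have mUC : measurable (U `&` C k : set E).
  by apply: open_measurable_euclid; exact: openI.
rewrite (le_trans _ (ltW mk))// -Rintegral_indicT//.
apply: Rintegral_bm_le.
- by apply: norm_indicB_measurable => //; exact: open_measurable_euclid.
- exact: bounded_measurable_indic.
move=> x; rewrite !indicE in_setI.
have [Ux|Ux] := boolP (x \in U); last first.
  rewrite /= subr0 (_ : g x = 0) ?normr0//.
  by apply: (Urysohn_sub0 sep); exists x => //; move: Ux; rewrite notin_setE.
have [Cx|Cx] := boolP (x \in C k) => /=.
  by have [_ /(_ x)/andP[g0 g1]] := ug; rewrite ler0_norm ?subr_le0// opprB; lra.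
rewrite (_ : g x = 1) ?subrr ?normr0//.
by apply: (Urysohn_sub1 sep); exists x => //; move: Cx; rewrite notin_setE.
Qed.

Let approximableC (A : set E) : approximable A -> approximable (~` A).
Proof.
move=> [mA aA]; split=> [|e /aA[g [ug ge]]]; first exact: measurableC.
exists (fun x => 1 - g x); split.
  split; last by move=> x; have [_ /(_ x)] := ug; lra.
  by move=> x; apply: continuousB; [exact: cst_continuous|exact: ug.1].
rewrite (le_trans _ ge)// le_eqVlt.
rewrite (@eq_Rintegral _ _ _ _ _ (fun x : E => `|g x - \1_A x|)) ?eqxx//.
move=> x _ /=; rewrite indicC indicE distrC; congr (`|_|).
by case: (x \in A) => /=; lra.
Qed.

Let approximableU (A B : set E) :
  approximable A -> approximable B -> approximable (A `|` B).
Proof.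
move=> [mA aA] [mB aB]; split=> [|e e0]; first exact: measurableU.
have e20 : 0 < e / 2 by lra.
have [[g [ug ge]] [h [uh he]]] := (aA _ e20, aB _ e20).
exists (fun x => Num.max (g x) (h x)); split.
  split; last first.
    move=> x; have [_ /(_ x)/andP[? ?]] := ug; have [_ /(_ x)/andP[? ?]] := uh.
    by rewrite le_max ge_max; apply/andP; split; [apply/orP; left|apply/andP].
  by move=> x; apply: continuous_max; [exact: ug.1|exact: uh.1].
rewrite [e]splitr (le_trans _ (lerD ge he))// -Rintegral_bmD; try exact: norm_indicB_measurable.
apply: Rintegral_bm_le.
- apply/bounded_measurable_norm/bounded_measurableB.
    by apply: bounded_measurable_max; exact: unit_continuous_measurable.
  by apply: bounded_measurable_indic; exact: measurableU.
- by apply: bounded_measurableD; exact: norm_indicB_measurable.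
move=> x; rewrite !indicE in_setU.
have [_ /(_ x)/andP[g0 g1]] := ug; have [_ /(_ x)/andP[h0 h1]] := uh.
case: (x \in A) => /=.
  rewrite (ler0_norm (_ : g x - 1 <= 0)); last lra.
  rewrite ler0_norm; last by rewrite subr_le0 ge_max g1.
  have : g x <= Num.max (g x) (h x) by rewrite le_max lexx.
  by have := normr_ge0 (h x - (x \in B)%:R); lra.
case: (x \in B) => /=.
  rewrite (ler0_norm (_ : h x - 1 <= 0)); last lra.
  rewrite ler0_norm; last by rewrite subr_le0 ge_max g1.
  have : h x <= Num.max (g x) (h x) by rewrite le_max lexx orbT.
  by have := normr_ge0 (g x - 0); lra.
rewrite !subr0 !ger0_norm// ?le_max ?g0//.
by rewrite ge_max; apply/andP; split; lra.
Qed.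

Let approximable_bigcup (F : (set E)^nat) :
  (forall k, approximable (F k)) -> approximable (\bigcup_k F k).
Proof.
move=> aF.
have mF : measurable (\bigcup_k F k).
  by apply: bigcupT_measurable => k; have [] := aF k.
have aG n : approximable (\big[setU/set0]_(i < n.+1) F i).
  elim: n => [|n ih]; first by rewrite big_ord_recr/= big_ord0 set0U.
  by rewrite big_ord_recr/=; exact: approximableU.
split => // e e0; have e20 : 0 < e / 2 by lra.
(* Finite unions are already approximable; [G n] is what they miss, and its measure tends to 0. *)
pose G n := \bigcup_k F k `\` \big[setU/set0]_(i < n.+1) F i.
have mG n : measurable (G n) by apply: measurableD => //; have [] := aG n.
have niG : nonincreasing_seq G.
  move=> k l kl; apply/subsetPset; apply: setDS.
  by rewrite -!bigcup_mkord; apply: bigcup_sub => i ik;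
    apply: bigcup_sup => /=; rewrite (leq_trans ik).
have G0 : \bigcap_n G n = set0.
  rewrite -subset0 => x Gx; have [[k _ Fx] _] := Gx 0%N I.
  by have [_] := Gx k I; apply; rewrite -bigcup_mkord; exists k => /=.
have [n Gn] := fine_measure_small m mG niG G0 e20.
have [mS /(_ _ e20)[g [ug ge]]] := aG n.
exists g; split => //.
rewrite [e]splitr (le_trans _ (lerD ge (ltW Gn)))// -Rintegral_indicT// -Rintegral_bmD.
- apply: Rintegral_bm_le.
  + exact: norm_indicB_measurable.
  + apply: bounded_measurableD; first exact: norm_indicB_measurable.
    exact: bounded_measurable_indic.
  + move=> x; set S := \big[setU/set0]_(i < n.+1) F i.
    rewrite (le_trans (ler_distD (\1_S x) _ _))// lerD2l !indicE in_setD.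
    have [xS|xS] := boolP (x \in S); last first.
      by rewrite sub0r normrN andbT ger0_norm.
    rewrite (_ : x \in \bigcup_k F k) ?subrr ?normr0//.
    move: xS; rewrite /S -bigcup_mkord inE => -[i _ Fi].
    by rewrite inE; exists i.
- exact: norm_indicB_measurable.
- exact: bounded_measurable_indic.
Qed.

Lemma indicator_approximation (A : set E) (e : R) : measurable A -> 0 < e ->
  exists g, unit_continuous g /\ \int[m]_x `|g x - \1_A x| <= e.
Proof.
move=> mA e0; suff [_] : approximable A by exact.
have : <<s [set U : set V | open U] >> A := mA.
apply: smallest_sub; last exact: approximable_open.
split.
- apply: approximable_open; exact: open0.
- by move=> B aB; rewrite setTD; exact: approximableC.
- by move=> F aF; exact: approximable_bigcup.
Qed.

End Density.

End Approximation.

(** * Functionals represented by measures *)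

(** The sum of the two measures works. A function close to an indicator for the sum is close for
    both, which links quantities computed with different measures. *)
Lemma finite_measure_dominating d (T : measurableType d) (R : realType)
    (m1 m2 : {finite_measure set T -> \bar R}) :
  exists m : {finite_measure set T -> \bar R}, forall f : T -> R,
    bounded_measurable f -> (forall x, 0 <= f x) ->
    \int[m1]_x f x <= \int[m]_x f x /\ \int[m2]_x f x <= \int[m]_x f x.
Proof.
pose mu := [the {measure set T -> \bar R} of measure_add m1 m2].
have finmu : fin_num_fun mu.
  move=> A mA; have -> : mu A = (m1 A + m2 A)%E := measure_addE m1 m2 A.
  by rewrite fin_numD !fin_num_measure.
pose m : {finite_measure set T -> \bar R} :=
  HB.pack (mu : set T -> \bar R) (Measure.class mu) (Measure_isFinite.Build _ _ _ mu finmu).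
exists m => f bf f0.
have -> : \int[m]_x f x = \int[m1]_x f x + \int[m2]_x f x.
  have [mf _] := bf.
  rewrite /Rintegral ge0_integral_measure_add//; last 2 first.
    by move=> x _; rewrite lee_fin.
    exact/measurable_EFinP.
  by rewrite fineD//; apply: integrable_fin_num => //; exact: bounded_measurable_integrable.
by rewrite lerDl lerDr !Rintegral_ge0.
Qed.

Section Representation.
Variables (R : realType) (d : nat).
Local Notation V := 'cV[R]_d.
Local Notation E := (euclid R d).

Lemma bounded_continuous_cst (c : R) : bounded_continuous (fun _ : V => c).
Proof. by split; [exact: cst_continuous|exists `|c|]. Qed.

Lemma bounded_continuousD (f g : V -> R) : bounded_continuous f ->
  bounded_continuous g -> bounded_continuous (fun x => f x + g x).
Proof.
move=> [cf [M fM]] [cg [N gN]]; split; first by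
  move=> x; apply: continuousD; [exact: cf|exact: cg].
by exists (M + N) => x; rewrite (le_trans (ler_normD _ _))// lerD.
Qed.

Lemma bounded_continuousZ (c : R) (f : V -> R) : bounded_continuous f ->
  bounded_continuous (fun x => c * f x).
Proof.
move=> [cf [M fM]]; split.
  by move=> x; apply: continuousM; [exact: cst_continuous|exact: cf].
by exists (`|c| * M) => x; rewrite normrM ler_wpM2l.
Qed.

Lemma bounded_continuousB (f g : V -> R) : bounded_continuous f ->
  bounded_continuous g -> bounded_continuous (fun x => f x - g x).
Proof.
move=> bf bg; have := bounded_continuousD bf (bounded_continuousZ (-1) bg).
by under eq_fun do rewrite mulN1r.
Qed.

Lemma bounded_continuous_max (f g : V -> R) : bounded_continuous f ->
  bounded_continuous g -> bounded_continuous (fun x => Num.max (f x) (g x)).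
Proof.
move=> [cf [M fM]] [cg [N gN]]; split; first by
  move=> x; apply: continuous_max; [exact: cf|exact: cg].
by exists (Num.max M N) => x; rewrite le_max; case: (leP (f x) (g x)) => _;
  rewrite ?fM ?gN ?orbT.
Qed.

Lemma bounded_continuous_sum (I : Type) (s : seq I) (F : I -> V -> R) :
  (forall i, bounded_continuous (F i)) ->
  bounded_continuous (fun x => \sum_(i <- s) F i x).
Proof.
move=> bF; elim: s => [|i s ih].
  under eq_fun do rewrite big_nil; exact: bounded_continuous_cst.
under eq_fun do rewrite big_cons; exact: bounded_continuousD.
Qed.

Definition linear_functional (L : (V -> R) -> R) :=
  (forall f g, bounded_continuous f -> bounded_continuous g ->
     L (fun x => f x + g x) = L f + L g) /\
  (forall c f, bounded_continuous f -> L (fun x => c * f x) = c * L f).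

Lemma linear_functionalB L f g : linear_functional L ->
  bounded_continuous f -> bounded_continuous g ->
  L (fun x => f x - g x) = L f - L g.
Proof.
move=> [LD LZ] bf bg; rewrite -mulN1r -LZ// -LD//; last exact: bounded_continuousZ.
by under [in RHS]eq_fun do rewrite mulN1r.
Qed.

Lemma linear_functional_sum L (I : Type) (s : seq I) (F : I -> V -> R) :
  linear_functional L -> (forall i, bounded_continuous (F i)) ->
  L (fun x => \sum_(i <- s) F i x) = \sum_(i <- s) L (F i).
Proof.
move=> [LD LZ] bF; elim: s => [|i s ih].
  under eq_fun do rewrite big_nil -(mulr0 0).
  by rewrite LZ ?mul0r ?big_nil//; exact: bounded_continuous_cst.
under eq_fun do rewrite big_cons.
by rewrite big_cons -ih LD//; exact: bounded_continuous_sum.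
Qed.

(** * Construction of a measure from a dominated functional *)

Section Functional.
Variable L : (V -> R) -> R.
Hypothesis linL : linear_functional L.
Hypothesis L1 : L (fun _ => 1) = 1.

(** The error is uniform over all [f] bounded above by 1, and [m] may depend on [e]. For [f <= 0]
    the bound reads [L f <= e], so domination for every [e] contains the positivity of [L]. *)
Let dominates (m : {finite_measure set E -> \bar R}) (e : R) :=
  forall f, bounded_continuous f -> (forall x, f x <= 1) ->
    L f <= \int[m]_x Num.max (f x) 0 + e.

Hypothesis domL : forall e : R, 0 < e -> exists m, dominates m e.

Let err (m : {finite_measure set E -> \bar R}) g A : R :=
  \int[m]_x `|g x - \1_A x|.

Let bm_err g A : unit_continuous g -> measurable (A : set E) ->
  bounded_measurable (fun x : E => `|g x - \1_A x|).
Proof.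
move=> ug mA; apply/bounded_measurable_norm/bounded_measurableB.
  exact: unit_continuous_measurable.
exact: bounded_measurable_indic.
Qed.

Let L_le m e g h A : dominates m e -> unit_continuous g ->
  unit_continuous h -> measurable (A : set E) ->
  (forall x, g x - h x <= `|h x - \1_A x|) -> L g <= L h + err m h A + e.
Proof.
move=> me ug uh mA gh.
have [bg bh] := (unit_continuous_bounded ug, unit_continuous_bounded uh).
suff : L (fun x => g x - h x) <= err m h A + e by rewrite linear_functionalB//; lra.
apply: le_trans (me _ (bounded_continuousB bg bh) _) _.
  by move=> x; have [_ /(_ x)] := ug; have [_ /(_ x)] := uh; lra.
rewrite lerD2r; apply: Rintegral_bm_le.
- by apply: bounded_continuous_measurable; apply: bounded_continuous_max;
    [exact: bounded_continuousB|exact: bounded_continuous_cst].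
- exact: bm_err.
- by move=> x; rewrite ge_max gh normr_ge0.
Qed.

Let L_compare m e g h A : dominates m e -> unit_continuous g ->
  unit_continuous h -> measurable (A : set E) ->
  L g <= L h + err m g A + err m h A + e.
Proof.
move=> me ug uh mA.
have [bg bh] := (unit_continuous_bounded ug, unit_continuous_bounded uh).
suff : L (fun x => g x - h x) <= err m g A + err m h A + e by rewrite linear_functionalB//; lra.
apply: le_trans (me _ (bounded_continuousB bg bh) _) _.
  by move=> x; have [_ /(_ x)] := ug; have [_ /(_ x)] := uh; lra.
rewrite lerD2r /err -Rintegral_bmD; try exact: bm_err.
apply: Rintegral_bm_le.
- by apply: bounded_continuous_measurable; apply: bounded_continuous_max;
    [exact: bounded_continuousB|exact: bounded_continuous_cst].
- by apply: bounded_measurableD; exact: bm_err.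
- move=> x; rewrite ge_max addr_ge0 ?normr_ge0// andbT.
  have := ler_norm (g x - \1_A x); have := ler_norm (- (h x - \1_A x)).
  by rewrite normrN; lra.
Qed.

(* [s A] is the only real number within [err m g A + e] of [L g] for all
   dominating pairs [(m, e)] and all [g] (lemma [s_spec]). *)
Let lower A : set R := [set r | exists m e g,
  [/\ dominates m e, unit_continuous g & r = L g - err m g A - e]].

Let s A : R := if pselect (measurable (A : set E)) then sup (lower A) else 0.

(** The intervals of radius [err m g A + e] around [L g] pairwise meet, so the supremum of their
    left ends lies in all of them. Two pairs with different measures are linked by a function [h]
    close to [\1_A] for a measure dominating both. *)
Let s_spec A m e g : measurable (A : set E) -> dominates m e ->
  unit_continuous g -> `|L g - s A| <= err m g A + e.
Proof.
move=> mA me ug; rewrite /s; case: pselect => [_ /=|//].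
have lu m1 e1 g1 m2 e2 g2 : dominates m1 e1 -> dominates m2 e2 ->
    unit_continuous g1 -> unit_continuous g2 ->
    L g1 - err m1 g1 A - e1 <= L g2 + err m2 g2 A + e2.
  move=> me1 me2 ug1 ug2; apply/ler_addgt0Pr => r r0.
  have [n mn] := finite_measure_dominating m1 m2.
  have r20 : 0 < r / 2 by lra.
  have [h [uh hr]] := indicator_approximation n mA r20.
  have [] := mn _ (bm_err uh mA) (fun x => normr_ge0 _).
  have := L_compare me1 ug1 uh mA; have := L_compare me2 uh ug2 mA.
  rewrite /err; lra.
have ls : ubound (lower A) (L g + err m g A + e).
  by move=> _ [m1 [e1 [g1 [me1 ug1 ->]]]]; exact: lu.
have lg : lower A (L g - err m g A - e) by exists m, e, g.
have lsup := ub_le_sup (ex_intro _ _ ls) lg.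
have sups := ge_sup (ex_intro _ _ lg) ls.
by rewrite ler_norml; apply/andP; split; lra.
Qed.

Let s_approx A (e : R) : measurable (A : set E) -> 0 < e -> exists m g r,
  [/\ 0 < r, dominates m r, unit_continuous g, err m g A + 2 * r <= e &
    `|L g - s A| <= e].
Proof.
move=> mA e0; have e30 : 0 < e / 3 by lra.
have [m me] := domL e30.
have [g [ug gA]] := indicator_approximation m mA e30.
exists m, g, (e / 3); split => //; first by rewrite /err; lra.
by rewrite (le_trans (s_spec mA me ug))// /err; lra.
Qed.

Let unit0 : unit_continuous (fun _ : V => 0).
Proof. by split; [exact: cst_continuous|move=> x; rewrite lexx ler01]. Qed.

Let unit1 : unit_continuous (fun _ : V => 1).
Proof. by split; [exact: cst_continuous|move=> x; rewrite lexx ler01]. Qed.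

Let L0 : L (fun _ => 0) = 0.
Proof.
have := linL.2 0 _ (bounded_continuous_cst 0).
by rewrite !mul0r.
Qed.

(** The error of the test function 0 in [s_spec] is the measure of [A] itself. This bound carries
    continuity at the empty set over from [m] to [s]. *)
Let s_dominated A m e : measurable (A : set E) -> dominates m e ->
  s A <= fine (m A) + e.
Proof.
move=> mA me; have := s_spec mA me unit0; rewrite L0 sub0r normrN /err.
under eq_Rintegral do rewrite sub0r normrN ger0_norm//.
by rewrite Rintegral_indicT//; exact: le_trans (ler_norm _).
Qed.

Let le_s A g : measurable (A : set E) -> unit_continuous g ->
  (forall x, g x <= \1_A x) -> L g <= s A.
Proof.
move=> mA ug gA; apply/ler_addgt0Pr => e e0.
have e20 : 0 < e / 2 by lra.
have [m [h [r [r0 mr uh hr hs]]]] := s_approx mA e20.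
have : L g <= L h + err m h A + r.
  apply: L_le => // x; rewrite (le_trans (lerB (gA x) (lexx _)))//.
  by rewrite distrC ler_norm.
by have := ler_norm (L h - s A); lra.
Qed.

(** Needed for every set, measurable or not, to build the measure structure; the default value 0 in
    [s] provides it. *)
Let s_ge0 A : 0 <= s A.
Proof.
rewrite {1}/s; case: pselect => // mA.
have -> : sup (lower A) = s A by rewrite /s; case: pselect.
by rewrite -L0; apply: le_s => // x; rewrite indicE ler0n.
Qed.

Let s0 : s set0 = 0.
Proof.
apply/eqP; rewrite eq_le s_ge0 andbT; apply/ler_addgt0Pr => e e0.
have [m me] := domL e0.
by have := s_dominated measurable0 me; rewrite measure0.
Qed.

Let s1 : s setT = 1.
Proof.
apply/eqP; rewrite eq_le -{2}L1; apply/andP; split; last first.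
  by apply: le_s => // x; rewrite indicE in_setT.
apply/ler_addgt0Pr => e e0; have [m me] := domL e0.
have := s_spec (measurableT : measurable (setT : set E)) me unit1; rewrite L1 /err.
under eq_Rintegral do rewrite indicE in_setT subrr normr0.
rewrite Rintegral_cst// mul0r distrC => /(le_trans (ler_norm _)); lra.
Qed.

Let sU A B : measurable (A : set E) -> measurable (B : set E) ->
  A `&` B = set0 -> s (A `|` B) = s A + s B.
Proof.
move=> mA mB AB; have mU := measurableU A B mA mB.
apply/eqP; rewrite -subr_eq0 -normr_le0; apply/ler_addgt0Pr => e e0.
(* The comparison of [f + g] with [h] costs [5 * r] and each of the three uses of [s_spec] costs
   [2 * r], which makes [11 * r] in all. *)
rewrite add0r; pose r := e / 16.
have r0 : 0 < r by rewrite /r; lra.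
have [m mr] := domL r0.
have [f [uf fr]] := indicator_approximation m mA r0.
have [g [ug gr]] := indicator_approximation m mB r0.
have [h [uh hr]] := indicator_approximation m mU r0.
have bf := unit_continuous_bounded uf.
have bg := unit_continuous_bounded ug.
have bh := unit_continuous_bounded uh.
have bfg := bounded_continuousD bf bg.
(* Domination applies only to functions at most 1, while [f + g - h] is bounded by 2; hence the
   factors [1/2] and [-1/2], one for each side of the estimate. *)
pose k c x := c * (f x + g x - h x).
have kr c : `|c| = 1 / 2 -> L (k c) <= 3 / 2 * r + r.
  move=> c1; apply: le_trans (mr (k c) _ _) _.
  - by apply: bounded_continuousZ; exact: bounded_continuousB.
  - move=> x; rewrite (le_trans (ler_norm _))// /k normrM c1.
    have [_ /(_ x)/andP[? ?]] := uf; have [_ /(_ x)/andP[? ?]] := ug.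
    have [_ /(_ x)/andP[? ?]] := uh.
    have : `|f x + g x - h x| <= 2 by rewrite ler_norml; apply/andP; split; lra.
    lra.
  rewrite lerD2r (@le_trans _ _
      (2^-1 * (err m f A + err m g B + err m h (A `|` B))))//; last first.
    by rewrite /err; lra.
  rewrite /err -Rintegral_bmD; try exact: bm_err.
  rewrite -Rintegral_bmD; [|apply: bounded_measurableD|]; try exact: bm_err.
  rewrite -Rintegral_bmZ; last first.
    by do 2 ?[apply: bounded_measurableD]; exact: bm_err.
  apply: Rintegral_bm_le.
  - apply: bounded_continuous_measurable; apply: bounded_continuous_max;
      last exact: bounded_continuous_cst.
    by apply: bounded_continuousZ; exact: bounded_continuousB.
  - apply: bounded_measurableM; first exact: bounded_measurable_cst.
    by do 2 ?[apply: bounded_measurableD]; exact: bm_err.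
  - move=> x; rewrite ge_max; apply/andP; split; last first.
      by rewrite mulr_ge0// !addr_ge0.
    rewrite (le_trans (ler_norm _))// /k normrM c1 mul1r ler_wpM2l//.
    have -> : f x + g x - h x = (f x - \1_A x) + (g x - \1_B x) - (h x - \1_(A `|` B) x).
      suff -> : \1_(A `|` B) x = \1_A x + \1_B x :> R by lra.
      rewrite !indicE in_setU; have [xA|_] := boolP (x \in A); last by rewrite add0r.
      rewrite (_ : x \in B = false) ?addr0//; apply/negP => xB.
      by have : (A `&` B) x; [split; exact: set_mem|rewrite AB].
    by rewrite (le_trans (ler_normB _ _))// lerD2r ler_normD.
have Lk c : L (k c) = c * (L f + L g - L h).
  by rewrite linL.2 ?linear_functionalB ?linL.1//; exact: bounded_continuousB.
have := kr (1/2); have := kr (- (1/2)); rewrite !Lk normrN ger0_norm; last lra.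
move=> /(_ erefl) k1 /(_ erefl) k2.
have /ler_normlP[f1 f2] := le_trans (s_spec mA mr uf) (lerD fr (lexx r)).
have /ler_normlP[g1 g2] := le_trans (s_spec mB mr ug) (lerD gr (lexx r)).
have /ler_normlP[h1 h2] := le_trans (s_spec mU mr uh) (lerD hr (lexx r)).
move: e0 f1 f2 g1 g2 h1 h2 k1 k2; rewrite /r ler_norml.
move: (s _) (s _) (s _) (L _) (L _) (L _) => sAB sA sB Lh Lg Lf.
by move=> *; apply/andP; split; lra.
Qed.

Let s_bigsetU (F : (set E)^nat) n : (forall k, measurable (F k)) ->
  trivIset setT F -> s (\big[setU/set0]_(i < n) F i) = \sum_(i < n) s (F i).
Proof.
move=> mF tF; elim: n => [|n ih]; first by rewrite !big_ord0 s0.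
rewrite !big_ord_recr/= sU ?ih//; first exact: bigsetU_measurable.
rewrite -bigcup_mkord -subset0 => x [[i /= im Fi] Fn].
by have im' := tF i n I I (ex_intro _ x (conj Fi Fn)); rewrite im' ltnn in im.
Qed.

Let mu (A : set E) : \bar R := (s A)%:E.

Let mu_ge0 A : (0 <= mu A)%E. Proof. by rewrite lee_fin. Qed.

Let mu0 : mu set0 = 0%E. Proof. by rewrite /mu s0. Qed.

(** By finite additivity the defect after [n] terms is [s (G n)], where the sets [G n] decrease to
    the empty set; [s_dominated] bounds it by [m (G n)] plus an arbitrarily small error. *)
Let mu_sigma_additive : semi_sigma_additive mu.
Proof.
move=> F mF tF mbF; rewrite /mu; under eq_fun do rewrite sumEFin big_mkord -s_bigsetU//.
apply/fine_cvgP; split => /=; first exact: nearW.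
pose G n := \bigcup_k F k `\` \big[setU/set0]_(i < n) F i.
have mS n : measurable (\big[setU/set0]_(i < n) F i : set E) by exact: bigsetU_measurable.
have mG n : measurable (G n) by exact: measurableD.
have SG n : s (\bigcup_k F k) = s (\big[setU/set0]_(i < n) F i) + s (G n).
  have -> : \bigcup_k F k = \big[setU/set0]_(i < n) F i `|` G n.
    rewrite /G setUC setUDl setDv setD0 setUidl// -bigcup_mkord.
    by move=> x [i _ Fi]; exists i.
  by apply: sU => //; rewrite /G setIDA setIC -setIDA setDv setI0.
have niG : nonincreasing_seq G.
  move=> k l kl; apply/subsetPset; apply: setDS.
  by rewrite -!bigcup_mkord; apply: bigcup_sub => i ik;
    apply: bigcup_sup => /=; rewrite (leq_trans ik).
have G0 : \bigcap_n G n = set0.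
  rewrite -subset0 => x Gx; have [[k _ Fx] _] := Gx 0%N I.
  by have [_] := Gx k.+1 I; apply; rewrite -bigcup_mkord; exists k => /=.
apply/cvgrPdist_le => e e0; have e20 : 0 < e / 2 by lra.
have [m me] := domL e20.
have [n Gn] := fine_measure_small m mG niG G0 e20.
exists n => // k /= nk; rewrite (SG k) addrC addKr ger0_norm//.
rewrite (le_trans (s_dominated (mG k) me))// [leRHS]splitr lerD2r.
rewrite (le_trans _ (ltW Gn))// fine_le ?fin_num_measure//.
by apply: le_measure; rewrite ?inE//; apply/subsetPset; exact: niG.
Unshelve. all: by end_near. Qed.

(** The content is the upper bound of [L f] by the integral for [f] with values in [0, 1]. Applied
    to [1 - f] it gives the reverse inequality, and an affine rescaling reaches every bounded
    continuous function. *)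
Lemma functional_representation : exists m : probability E R,
  forall f, bounded_continuous f -> L f = \int[m]_x f x.
Proof.
have [m mE] : exists m : probability E R, forall A, fine (m A) = s A.
  pose m0 : {measure set E -> \bar R} :=
    HB.pack mu (isMeasure.Build _ _ _ mu mu0 mu_ge0 mu_sigma_additive).
  have m01 : m0 setT = 1%E by rewrite /m0/= /mu s1.
  pose m : probability E R :=
    HB.pack mu (Measure.class m0) (Measure_isProbability.Build _ _ _ m0 m01).
  by exists m.
have upper f : unit_continuous f -> L f <= \int[m]_x f x.
  move=> uf; apply/ler_addgt0Pr => e e0.
  have [N] := ltr_add_invr e0; rewrite add0r => Ne.
  have N0 : 0 < N.+1%:R :> R by rewrite ltr0n.
  (* layers: [f] is the sum of the [c i.+1 - c i], each at most
     [N.+1%:R^-1 * \1_(A i)] *)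
  pose c i : V -> R := fun x => Num.min (f x) (i%:R / N.+1%:R).
  pose A i : set E := [set x | i%:R / N.+1%:R < f x].
  have mA i : measurable (A i).
    apply: open_measurable_euclid; rewrite (_ : A i = f @^-1` `]i%:R / N.+1%:R, +oo[%classic).
      by have /continuousP := uf.1; apply; exact: interval_open.
    by apply/seteqP; split => x; rewrite /= in_itv/= andbT.
  have bc i : bounded_continuous (c i).
    have bf := unit_continuous_bounded uf.
    have := bounded_continuousB bf (bounded_continuous_max
       (bounded_continuousB bf (bounded_continuous_cst (i%:R / N.+1%:R)))
       (bounded_continuous_cst 0)).
    congr bounded_continuous; apply/funext => x; rewrite /c.
    have [h|/ltW h] := leP (f x) (i%:R / N.+1%:R).
      by rewrite max_r ?subr_le0// subr0.
    by rewrite max_l ?subr_ge0// opprB addrC subrK.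
  have min_step (a b t : R) : 0 < b -> a < t -> 0 <= Num.min t (a + b) - a <= b.
    by move=> b0 at_; have [?|?] := leP t (a + b); apply/andP; split; lra.
  have c01 i x : 0 <= c i.+1 x - c i x <= N.+1%:R^-1 * \1_(A i) x.
    have ii : i.+1%:R / N.+1%:R = i%:R / N.+1%:R + N.+1%:R^-1 :> R.
      by rewrite -addn1 natrD mulrDl mul1r.
    have N'0 : 0 < N.+1%:R^-1 :> R by rewrite invr_gt0.
    rewrite /c ii indicE; have [xA|xA] := boolP (x \in A i).
      have fx : i%:R / N.+1%:R < f x := set_mem xA; rewrite (min_r (ltW fx)).
      by rewrite /= mulr1; exact: min_step.
    have : f x <= i%:R / N.+1%:R by move: xA; rewrite notin_setE /A/= => /negP; rewrite -leNgt.
    move=> fx; rewrite /= mulr0 (min_l fx) min_l ?subrr ?lexx//.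
    by rewrite (le_trans fx)// lerDl ltW.
  have c0 x : c 0%N x = 0 by rewrite /c mul0r min_r//; have [_ /(_ x)/andP[]] := uf.
  have cf n x : \sum_(i < n) (c i.+1 x - c i x) = c n x.
    by rewrite -(big_mkord xpredT (fun i => c i.+1 x - c i x)) telescope_sumr// c0 subr0.
  have bci i : bounded_continuous (fun x => c i.+1 x - c i x) by exact: bounded_continuousB.
  have Lc i : L (fun x => c i.+1 x - c i x) <= N.+1%:R^-1 * s (A i).
    rewrite ler_pdivlMl// -linL.2//; apply: le_s => // [|x]; last first.
      by have /andP[_] := c01 i x; rewrite ler_pdivlMl.
    split; first by have [] := bounded_continuousZ N.+1%:R (bci i).
    move=> x; have /andP[ci0 ci1] := c01 i x; rewrite mulr_ge0//= -ler_pdivlMl//.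
    by rewrite (le_trans ci1)// ler_pM2l ?invr_gt0// indicE lern1 leq_b1.
  have fE : f = fun x => \sum_(i < N.+1) (c i.+1 x - c i x).
    apply/funext => x; rewrite cf /c divff ?lt0r_neq0// min_l//.
    by have [_ /(_ x)/andP[]] := uf.
  have iA i : bounded_measurable (fun x => N.+1%:R^-1 * \1_(A i) x : R).
    by apply: bounded_measurableM;
      [exact: bounded_measurable_cst|exact: bounded_measurable_indic].
  have LA : L f <= \int[m]_x \sum_(i < N.+1) N.+1%:R^-1 * \1_(A i) x.
    rewrite Rintegral_bm_sum// [in leLHS]fE linear_functional_sum//.
    apply: ler_sum => i _; rewrite Rintegral_bmZ//; last exact: bounded_measurable_indic.
    by rewrite Rintegral_indicT// mE.
  have bf := unit_continuous_measurable uf.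
  apply: (le_trans LA); apply: (@le_trans _ _ (\int[m]_x (f x + N.+1%:R^-1))).
    apply: Rintegral_bm_le.
    - exact: bounded_measurable_sum.
    - by apply: bounded_measurableD => //; exact: bounded_measurable_cst.
    (* The indicator of index 0 is paid for by the extra [N.+1%:R^-1]. On [A i.+1] the layer of
       index [i] is full, so the other indicators sum to at most [c N x <= f x]. *)
    move=> x; rewrite big_ord_recl addrC lerD//; last first.
      by rewrite -[leRHS]mulr1 ler_pM2l ?invr_gt0// indicE lern1 leq_b1.
    apply: (@le_trans _ _ (c N x)); last by rewrite /c ge_min lexx.
    rewrite -cf; apply: ler_sum => i _; rewrite indicE.
    have [xA|_] := boolP (_ \in _); last by rewrite mulr0; have /andP[] := c01 i x.
    have fx : i.+1%:R / N.+1%:R < f x := set_mem xA.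
    have ii : i.+1%:R / N.+1%:R = i%:R / N.+1%:R + N.+1%:R^-1 :> R.
      by rewrite -addn1 natrD mulrDl mul1r.
    have N'0 : 0 < N.+1%:R^-1 :> R by rewrite invr_gt0.
    have fi : i%:R / N.+1%:R <= f x by rewrite (le_trans _ (ltW fx))// ii lerDl ltW.
    by rewrite /c (min_r (ltW fx)) (min_r fi) ii addrC addKr /= mulr1.
  rewrite Rintegral_bmD//; last exact: bounded_measurable_cst.
  by rewrite Rintegral_cst// mE s1 mulr1 lerD2l ltW.
exists m => f [cf [M fM]].
pose K := `|M| + 1; have K0 : 0 < K by rewrite /K; have := normr_ge0 M; lra.
have fK x : - K <= f x <= K by have := ler_norm M; have := fM x; rewrite ler_norml /K; lra.
have unit_eq g : unit_continuous g -> L g = \int[m]_x g x.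
  move=> ug; apply/eqP; rewrite eq_le upper//=.
  have bg := unit_continuous_bounded ug.
  have u1g : unit_continuous (fun x => 1 - g x).
    split; last by move=> x; have [_ /(_ x)] := ug; lra.
    by have [] := bounded_continuousB (bounded_continuous_cst 1) bg.
  have := upper _ u1g; rewrite linear_functionalB//; last exact: bounded_continuous_cst.
  rewrite L1 Rintegral_bmB//;
    [|exact: bounded_measurable_cst|exact: bounded_continuous_measurable].
  by rewrite Rintegral_cst// mE s1; lra.
pose g x := (2 * K)^-1 * (f x + K).
have bfK : bounded_continuous (fun x => f x + K).
  by apply: bounded_continuousD; [split => //; exists M|exact: bounded_continuous_cst].
have bg : bounded_continuous g by exact: bounded_continuousZ.
have ug : unit_continuous g.
  split; first by have [] := bg.
  move=> x; rewrite /g mulr_ge0 ?invr_ge0; [|lra|have := fK x; lra].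
  by rewrite ler_pdivrMl ?mulr1; have := fK x; lra.
have fE : f = fun x => 2 * K * g x - K.
  by apply/funext => x; rewrite /g mulVKf ?addrK//; lra.
rewrite fE linear_functionalB//; [|exact: bounded_continuousZ|exact: bounded_continuous_cst].
rewrite Rintegral_bmB; [|apply: bounded_continuous_measurable|];
  [|exact: bounded_continuousZ|exact: bounded_measurable_cst].
rewrite Rintegral_bmZ; last exact: bounded_continuous_measurable.
rewrite linL.2// unit_eq//; congr (_ - _).
have LK : L (fun _ => K) = K.
  by have := linL.2 K _ (bounded_continuous_cst 1); rewrite L1 !mulr1.
by rewrite LK Rintegral_cst// mE s1 mulr1.
Qed.

End Functional.

End Representation.

(** * Linear recurrences *)

Section Recurrence.
Variable C : numClosedFieldType.
Implicit Types (u : int -> C) (p : {poly C}).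

Definition vanishing (K : numDomainType) (u : int -> K) :=
  forall e : K, 0 < e -> exists n : nat, forall k : int, (n <= `|k|)%N -> `|u k| < e.

(* ['X] acts as the shift; any [n >= size p] gives the same value. *)
Let act n p u (k : int) := \sum_(i < n) p`_i * u (k + i%:Z).

(** A factor ['X - z%:P] of the polynomial can be moved onto the sequence, as a difference operator
    of order one. *)
Let act_mulXsubC n p z u k : (size p <= n)%N ->
  act n.+1 (p * ('X - z%:P)) u k = act n p (fun k => u (k + 1) - z * u k) k.
Proof.
move=> pn; rewrite /act.
have pn0 : p`_n = 0 by rewrite nth_default.
transitivity (\sum_(i < n.+1) (p * 'X)`_i * u (k + i%:Z) -
  \sum_(i < n.+1) z * p`_i * u (k + i%:Z)).
  by rewrite -sumrB; apply: eq_bigr => i _; rewrite mulrBr coefB coefMC mulrBl [p`_i * z]mulrC.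
rewrite big_ord_recl coefMX/= mul0r add0r [X in _ - X]big_ord_recr/= pn0.
rewrite mulr0 mul0r addr0 -sumrB.
apply: eq_bigr => i _; rewrite coefMX/= mulrBr; congr (_ * u _ - _).
  by rewrite /bump/= -addrA -PoszD addn1.
by rewrite mulrA [z * _]mulrC.
Qed.

(** If [|z| <= 1] the modulus of [u] does not decrease towards minus infinity, otherwise it does not
    decrease towards plus infinity; a nonzero value would persist on that side. *)
Let geometric_vanishing z u : vanishing u -> (forall k, u (k + 1) = z * u k) ->
  forall k, u k = 0.
Proof.
move=> vu uz k; apply/eqP; apply: contraT; rewrite -normr_gt0 => uk.
have [n un] := vu _ uk.
have ge (m : int) : (n <= `|m|)%N -> ~ (`|u k| <= `|u m|).
  by move=> /un um; apply/negP; rewrite -real_ltNge.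
have [z1|z1] := real_leP (normr_real z) (real1 C).
  have ukj j : `|u k| <= `|u (k - j%:Z)|.
    elim: j => [|j ih]; first by rewrite subr0.
    rewrite (le_trans ih)// (_ : k - j%:Z = (k - j.+1%:Z) + 1); last by lia.
    by rewrite uz normrM ler_piMl.
  by exfalso; apply: (@ge (k - (n + `|k|)%N%:Z)) => //; lia.
have ukj j : `|u k| <= `|u (k + j%:Z)|.
  elim: j => [|j ih]; first by rewrite addr0.
  rewrite (le_trans ih)// (_ : k + j.+1%:Z = (k + j%:Z) + 1); last by lia.
  by rewrite uz normrM ler_peMl// ltW.
by exfalso; apply: (@ge (k + (n + `|k|)%N%:Z)) => //; lia.
Qed.

(** Induction on the roots: [u (k + 1) - z * u k] vanishes at both ends and satisfies the recurrence
    of the remaining roots, so it is zero and [u] is geometric. *)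
Let act_prod_vanishing (s : seq C) u : vanishing u ->
  (forall k, act (size s).+1 (\prod_(z <- s) ('X - z%:P)) u k = 0) ->
  forall k, u k = 0.
Proof.
elim: s u => [u _ u0 k|z s ih u vu uz].
  by have := u0 k; rewrite /act big_nil big_ord_recl big_ord0 coef1 mul1r !addr0.
apply: (geometric_vanishing vu (z := z)).
suff h k : u (k + 1) - z * u k = 0 by move=> k; apply/eqP; rewrite -subr_eq0 h.
move: k; apply: ih => [e e0|k]; last first.
  have := uz k; rewrite big_cons mulrC act_mulXsubC//.
  by rewrite size_prod_XsubC.
have d0 : 0 < e / (2 * (`|z| + 1)) by rewrite divr_gt0 ?mulr_gt0// ltr_wpDl.
have e20 : 0 < e / 2 by rewrite divr_gt0.
have [[n un] [m um]] := (vu _ e20, vu _ d0).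
exists (n.+1 + m)%N => k km; rewrite (le_lt_trans (ler_normB _ _))// [ltRHS]splitr ltr_leD//.
  by apply: un; lia.
rewrite normrM (@le_trans _ _ ((`|z| + 1) * `|u k|))//.
  by rewrite ler_wpM2r// lerDl.
rewrite mulrC -ler_pdivlMr ?ltr_wpDl// -mulrA -invfM.
by apply/ltW/um; lia.
Qed.

Lemma poly_annihilates_vanishing p u : p != 0 -> vanishing u ->
  (forall k, \sum_(i < size p) p`_i * u (k + i%:Z) = 0) -> forall k, u k = 0.
Proof.
move=> p0 vu; have [s ps] := closed_field_poly_normal p.
have lp : lead_coef p != 0 by rewrite lead_coef_eq0.
rewrite ps size_scale// size_prod_XsubC => pu; apply: (act_prod_vanishing (s := s)) => // k.
apply: (mulfI lp); rewrite mulr0 -[RHS](pu k) /act mulr_sumr.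
by apply: eq_bigr => i _; rewrite coefZ mulrA.
Qed.

End Recurrence.

(* The characteristic polynomial is nonzero because its value at 1 is [size s]. *)
Lemma vanishing_convolution (R : realType) (s : seq int) (c : int -> R) :
  s != [::] -> vanishing c -> (forall k, \sum_(b <- s) c (k - b) = 0) ->
  forall k, c k = 0.
Proof.
move=> s0 vc sc k; pose u (j : int) : R[i] := (c j)%:C%C.
suff : u k = 0 by case.
(* [K] bounds every [|b|], so the exponents [K - b] are natural numbers and the convolution becomes
   a one-sided recurrence. *)
pose K := \sum_(b <- s) `|b|%N.
pose t b := `|K%:Z - b|%N.
have tE b : b \in s -> (t b)%:Z = K%:Z - b.
  move=> bs; suff : (`|b| <= K)%N by rewrite /t; lia.
  by rewrite /K (perm_big _ (perm_to_rem bs)) big_cons leq_addr.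
pose p : {poly R[i]} := \sum_(b <- s) 'X^(t b).
have p0 : p != 0.
  apply: contra_neq s0 => p0; have := congr1 (fun q => q.[1]) p0.
  rewrite horner0 /p horner_sum big_seq.
  under eq_bigr => b _ do rewrite hornerXn expr1n.
  rewrite -big_seq big_const_seq count_predT iter_addr_0.
  by case: {+}s => // b r /eqP; rewrite pnatr_eq0.
have pu n j : (size p <= n)%N ->
    \sum_(i < n) p`_i * u (j + i%:Z) = \sum_(i < size p) p`_i * u (j + i%:Z).
  move=> pn; rewrite [RHS](big_ord_widen n (fun i => p`_i * u (j + i%:Z)))// [RHS]big_mkcond/=.
  by apply: eq_bigr => i _; case: ltnP => // ip; rewrite nth_default// mul0r.
move: k; apply: (poly_annihilates_vanishing p0) => [e e0|k].
  case: e e0 => a b; rewrite ltcE/= => /andP[/eqP b0 a0].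
  have {b0}-> : b = 0 by [].
  by have [n cn] := vc _ a0; exists n => k /cn;
    rewrite /u normc_def/= expr0n addr0 sqrtr_sqr ltcR.
pose n := (size p + \sum_(b <- s) (t b).+1)%N.
have tn b : b \in s -> (t b < n)%N.
  by move=> bs; rewrite /n (perm_big _ (perm_to_rem bs)) big_cons addnCA leq_addr.
rewrite -(pu n) ?leq_addr// /p.
under eq_bigr do rewrite coef_sum mulr_suml.
rewrite exchange_big/= big_seq.
under eq_bigr => b bs.
  rewrite (bigD1 (Ordinal (tn b bs)))//= coefXn eqxx mul1r big1 ?addr0; last first.
    by move=> i; rewrite -val_eqE coefXn/= => /negbTE ->; rewrite mul0r.
  rewrite tE//.
  over.
rewrite -big_seq -(raddf_sum (real_complex R)).
transitivity ((\sum_(b <- s) c (k + K%:Z - b))%:C%C : R[i]); last by rewrite sc.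
by congr (_%:C%C); apply: eq_bigr => b _; congr c; lia.
Qed.

(** The lowest digit is a multiple of [N] smaller than [N] in absolute value, hence zero; divide by
    [N] and repeat. Digits may be negative, as they will be differences of coordinates. *)
Lemma base_expansion_eq0 (N n : nat) (w : 'I_n -> int) :
  (forall i, `|w i| < N)%N -> \sum_i w i * N%:Z ^+ i = 0 -> forall i, w i = 0.
Proof.
elim: n w => [w _ _ [//]|n ih w wN]; rewrite big_ord_recl expr0 mulr1 => w0.
have E : \sum_(i < n) w (lift ord0 i) * N%:Z ^+ lift ord0 i =
    N%:Z * \sum_(i < n) w (lift ord0 i) * N%:Z ^+ i.
  by rewrite mulr_sumr; apply: eq_bigr => i _; rewrite /= /bump/= exprS mulrCA.
rewrite E in w0; set S := \sum_(i < n) _ in w0.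
have N0 := wN ord0.
have S0 : S = 0.
  apply/eqP; apply: contraT => S0.
  have : (N <= `|w ord0|)%N.
    by rewrite (_ : w ord0 = - (N%:Z * S)) ?abszN ?abszM/= ?leq_pmulr ?absz_gt0//; lia.
  by rewrite leqNgt N0.
have w00 : w ord0 = 0 by move: w0; rewrite S0 mulr0 addr0.
move=> i; case: (unliftP ord0 i) => [j ->|->//].
exact: (ih (fun j => w (lift ord0 j))).
Qed.

(** * Averaging operators *)

Section Averages.
Variables (R : realType) (d : nat).
Local Notation V := 'cV[R]_d.
Local Notation E := (euclid R d).

Definition average (A : {fset V}) (f : V -> R) (x : V) : R :=
  #|` A|%:R^-1 * \sum_(a <- A) f (x + a).

Lemma translation_continuous (a : V) : continuous (fun x : V => x + a).
Proof. by move=> x; apply: continuousD; [exact: cvg_id|exact: cst_continuous]. Qed.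

Lemma measurable_translation (a : V) :
  measurable_fun [set: E] (fun x : E => (x : V) + a : E).
Proof.
apply: (@measurability _ _ E E setT _ [set U : set V | open U]) => // _ [U oU <-].
rewrite setTI; apply: open_measurable_euclid.
by have /continuousP := @translation_continuous a; exact.
Qed.

Lemma bounded_measurable_translation (f : V -> R) (a : V) :
  bounded_measurable (f : E -> R) -> bounded_measurable (fun x : E => f ((x : V) + a)).
Proof.
move=> [mf [M fM]]; split; last by exists M => x.
exact: (measurableT_comp mf (measurable_translation a)).
Qed.

Lemma bounded_measurable_average (A : {fset V}) (f : V -> R) :
  bounded_measurable (f : E -> R) -> bounded_measurable (average A f : E -> R).
Proof.
move=> bf; apply: bounded_measurableM; first exact: bounded_measurable_cst.
by apply: bounded_measurable_sum => a; exact: bounded_measurable_translation.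
Qed.

Lemma bounded_continuous_translation (f : V -> R) (a : V) :
  bounded_continuous f -> bounded_continuous (fun x => f (x + a)).
Proof.
move=> [cf [M fM]]; split; last by exists M => x.
by move=> x; apply: continuous_comp; [exact: translation_continuous|exact: cf].
Qed.

Lemma bounded_continuous_average (A : {fset V}) (f : V -> R) :
  bounded_continuous f -> bounded_continuous (average A f).
Proof.
move=> bf; apply: bounded_continuousZ.
by apply: bounded_continuous_sum => a; exact: bounded_continuous_translation.
Qed.

Lemma averageD (A : {fset V}) (f g : V -> R) x :
  average A (fun y => f y + g y) x = average A f x + average A g x.
Proof. by rewrite /average big_split mulrDr. Qed.

Lemma averageZ (A : {fset V}) (c : R) (f : V -> R) x :
  average A (fun y => c * f y) x = c * average A f x.
Proof. by rewrite /average -mulr_sumr mulrCA. Qed.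

Lemma average_cst (A : {fset V}) (c : R) x : A != fset0 ->
  average A (fun _ => c) x = c.
Proof.
move=> A0; rewrite /average big_const_seq count_predT iter_addr_0 -[c *+ _]mulr_natl mulKf//.
by rewrite pnatr_eq0 -lt0n cardfs_gt0.
Qed.

Lemma average_le (A : {fset V}) (f g : V -> R) x : (forall y, f y <= g y) ->
  average A f x <= average A g x.
Proof.
by move=> fg; rewrite /average ler_wpM2l ?invr_ge0//; apply: ler_sum => a _.
Qed.

Lemma average_norm_le (A : {fset V}) (f : V -> R) (c : R) x : 0 <= c ->
  (forall y, `|f y| <= c) -> `|average A f x| <= c.
Proof.
move=> c0 fc; have [->|A0] := eqVneq A fset0.
  by rewrite /average big_seq_fset0 mulr0 normr0.
have fcc y : - c <= f y <= c by rewrite -ler_norml.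
rewrite ler_norml; apply/andP; split.
  by rewrite -(average_cst (- c) x A0); apply: average_le => y; have /andP[] := fcc y.
by rewrite -[leRHS](average_cst c x A0); apply: average_le => y; have /andP[] := fcc y.
Qed.

Lemma averageC (A B : {fset V}) (f : V -> R) x :
  average A (average B f) x = average B (average A f) x.
Proof.
rewrite /average -!mulr_sumr mulrCA; do 2 congr (_ * _).
rewrite exchange_big/=; apply: eq_bigr => b _; apply: eq_bigr => a _.
by rewrite addrAC.
Qed.

Lemma ge0_integral_delta_measure (A : {fset V}) (f : V -> R) :
  measurable_fun [set: E] f -> (forall x, 0 <= f x) ->
  (\int[delta_measure A]_x (f x)%:E)%E = (#|` A|%:R^-1 * \sum_(a <- A) f a)%:E.
Proof.
move=> mf f0; have mfE : measurable_fun [set: E] (EFin \o f) by exact/measurable_EFinP.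
have f0E x : (0 <= (EFin \o f) x)%E by rewrite lee_fin.
rewrite [LHS]ge0_integral_mscale//; last by move=> y _; exact: f0E.
rewrite [RHS]EFinM; congr (_ * _)%E.
rewrite ge0_integral_measure_sum//; last by move=> y _; exact: f0E.
rewrite (big_nth (0 : V)) big_mkord -sumEFin; apply: eq_bigr => i _.
by rewrite integral_dirac// diracT mul1e.
Qed.

(** The formula for nonnegative integrands, applied to [f + |M|] and to the constant [|M|], gives
    the general case by subtraction. [integral_convolution] follows the same route. *)
Lemma integral_delta_measure (A : {fset V}) (f : V -> R) :
  bounded_measurable (f : E -> R) -> \int[delta_measure A]_x f x = average A f 0.
Proof.
move=> bf; have [mf [M fM]] := bf.
have bcst c := @bounded_measurable_cst _ E R c.
have fM0 x : 0 <= f x + `|M|.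
  by have := ler_norm (- f x); have := fM x; have := ler_norm M; rewrite normrN; lra.
have ge0_delta g : bounded_measurable (g : E -> R) -> (forall x, 0 <= g x) ->
    \int[delta_measure A]_x g x = average A g 0.
  move=> [mg _] g0; rewrite /Rintegral ge0_integral_delta_measure//=.
  by congr (_ * _); apply: eq_bigr => a _; rewrite add0r.
have := ge0_delta _ (bounded_measurableD bf (bcst `|M|)) fM0.
rewrite averageD Rintegral_bmD// (ge0_delta _ (bcst `|M|))//; exact: addIr.
Qed.

Let integral_convolution_ge0 (m : subprobability E R) (A : {fset V}) (f : V -> R) :
  bounded_measurable (f : E -> R) -> (forall x, 0 <= f x) ->
  \int[convolution m (delta_measure A)]_x f x = \int[m]_x average A f x.
Proof.
move=> [mf _] f0; rewrite /Rintegral; congr fine.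
have mfE : measurable_fun [set: E] (EFin \o f) by exact/measurable_EFinP.
have f0E x : (0 <= (EFin \o f) x)%E by rewrite lee_fin.
have := giry_int_map (@measurable_addE R d)
  (product_subprobability (m, delta_measure A : subprobability E R)) mfE f0E.
rewrite /giry_int -/(convolution m (delta_measure A)) => ->.
have mh : measurable_fun [set: E * E] ((EFin \o f) \o (@addE R d)).
  by apply: measurableT_comp => //; exact: measurable_addE.
have := giry_int_prod1 m (delta_measure A) mh (fun x => f0E _).
rewrite /giry_int => ->; apply: eq_integral => x _.
have mfx : measurable_fun [set: E] (fun y : E => (f ((x : V) + (y : V)))%:E).
  have := measurableT_comp mfE (measurable_translation (x : V)).
  by apply: eq_measurable_fun => y _ /=; rewrite addrC.
by rewrite [LHS]ge0_integral_delta_measure//; exact/measurable_EFinP.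
Qed.

Lemma integral_convolution (m : subprobability E R) (A : {fset V}) (f : V -> R) :
  bounded_measurable (f : E -> R) ->
  \int[convolution m (delta_measure A)]_x f x = \int[m]_x average A f x.
Proof.
move=> bf; have [_ [M fM]] := bf.
have bcst c := @bounded_measurable_cst _ E R c.
have fM0 x : 0 <= f x + `|M|.
  by have := ler_norm (- f x); have := fM x; have := ler_norm M; rewrite normrN; lra.
have := integral_convolution_ge0 m A (bounded_measurableD bf (bcst `|M|)) fM0.
have -> : average A (fun x => f x + `|M|) = fun x => average A f x + average A (fun=> `|M|) x.
  by apply/funext => x; rewrite averageD.
rewrite !Rintegral_bmD//; try exact: bounded_measurable_average.
by rewrite (integral_convolution_ge0 m A (bcst `|M|)) => [/addIr|x]//; exact: normr_ge0.
Qed.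

Lemma bounded_continuous_determines (m m' : {finite_measure set E -> \bar R}) :
  (forall f, bounded_continuous f -> \int[m]_x f x = \int[m']_x f x) ->
  forall U, measurable U -> fine (m U) = fine (m' U).
Proof.
move=> mm' U mU; apply/eqP; rewrite -subr_eq0 -normr_le0.
apply/ler_addgt0Pr => e e0; rewrite add0r.
have [n mn] := finite_measure_dominating m m'.
have e20 : 0 < e / 2 by lra.
have [g [ug ge]] := indicator_approximation n mU e20.
have bg := unit_continuous_measurable ug.
have bU := @bounded_measurable_indic _ _ R _ mU.
have bgU := bounded_measurableB bg bU.
have [n1 n2] := mn _ (bounded_measurable_norm bgU) (fun x => normr_ge0 _).
have near_m (k : {finite_measure set E -> \bar R}) :
    \int[k]_x `|g x - \1_U x| <= \int[n]_x `|g x - \1_U x| ->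
    `|\int[k]_x g x - fine (k U)| <= e / 2.
  move=> kn; rewrite -Rintegral_indicT// -Rintegral_bmB//.
  apply: le_trans (le_trans kn ge).
  by apply: le_normr_Rintegral => //; exact: bounded_measurable_integrable.
have := near_m _ n1; rewrite (mm' g); last exact: unit_continuous_bounded.
rewrite distrC => mg.
rewrite [leRHS]splitr; apply: (le_trans (ler_distD (\int[m']_x g x) _ _)).
exact: lerD mg (near_m _ n2).
Qed.

Lemma eq_Rintegral_measure (m m' : {finite_measure set E -> \bar R}) (f : E -> R) :
  (forall U, measurable U -> fine (m U) = fine (m' U)) ->
  \int[m]_x f x = \int[m']_x f x.
Proof.
move=> mm'; rewrite /Rintegral; congr fine; apply: eq_measure_integral => U mU _.
rewrite -[LHS]fineK ?fin_num_measure// -[RHS]fineK ?fin_num_measure//.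
by congr EFin; exact: mm'.
Qed.

End Averages.

(** * Cancellation of a finitely supported factor *)

Section Cancellation.
Variables (R : realType) (d : nat).
Local Notation V := 'cV[R]_d.
Local Notation E := (euclid R d).
Local Notation Z := 'cV[int]_d.
Variable A : 'M[int]_d.
Let G : 'M[R]_d := map_mx intr A.
Hypothesis G_unit : G \in unitmx.

Let embed (z : Z) : V := invmx G *m map_mx intr z.

Let embedD y z : embed (y + z) = embed y + embed z.
Proof. by rewrite /embed -mulmxDr map_mxD. Qed.

Lemma invmx_intr_inj : injective (fun z : Z => invmx G *m map_mx intr z : V).
Proof.
move=> y z /(congr1 (mulmx G)); rewrite !mulKVmx// => /matrixP yz.
by apply/matrixP => i j; have := yz i j; rewrite !mxE => /intr_inj.
Qed.

Lemma card_inv_image (B : {fset Z}) : #|` inv_image R A B| = #|` B|.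
Proof. by rewrite card_imfset//; exact: invmx_intr_inj. Qed.

Lemma sum_inv_image (B : {fset Z}) (F : V -> R) :
  \sum_(a <- inv_image R A B) F a =
  \sum_(b <- B) F (invmx G *m map_mx intr b).
Proof. by rewrite big_imfset//= => y z _ _; exact: invmx_intr_inj. Qed.

(* [x] lies in the lattice cell [A^-1 (cell x + [0, 1)^d)]. *)
Let cell (x : V) : Z := \col_i Num.floor ((G *m x) i 0).

Let cellD x z : cell (x + embed z) = cell x + z.
Proof.
apply/matrixP => i j; rewrite (ord1 j).
have E : (G *m (x + embed z)) i 0 = (G *m x) i 0 + (z i 0)%:~R.
  by rewrite mulmxDr mulKVmx// !mxE.
by rewrite [LHS]mxE E floorDrz ?intr_int// intrKfloor !mxE.
Qed.

(** The set splits along the countably many cells. Letting [W] depend on the cell covers conditions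
    in which [x] is translated by its own cell. *)
Let measurable_cell (P : set Z) (W : Z -> set E) : (forall z, measurable (W z)) ->
  measurable [set x : E | P (cell x) /\ W (cell x) x].
Proof.
move=> mW.
have -> : [set x : E | P (cell x) /\ W (cell x) x] =
    \bigcup_(z in P) ([set x : E | cell x = z] `&` W z).
  apply/seteqP; split => [x [Px Wx]|x [z Pz [/= xz Wx]]]; last by rewrite /= xz.
  by exists (cell x).
rewrite bigcup_mkcond; apply: countable_bigcupT_measurable => [|z].
  exact: countableP.
case: ifP => _; last exact: measurable0.
apply: measurableI => //.
have -> : [set x : E | cell x = z] = \bigcap_(i in [set: 'I_d])
    ((fun x : E => ((G *m (x : V)) i 0 : R)) @^-1` `[(z i 0)%:~R, (z i 0 + 1)%:~R[%classic).
  apply/seteqP; split => [x <- i _|x xz].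
    by rewrite /= in_itv/= mxE floor_le_tmp floorD1_gt.
  apply/matrixP => i j; rewrite (ord1 j) mxE; apply: floor_def.
  by have := xz i I; rewrite /= in_itv/=.
apply: fin_bigcap_measurable => [|i _]; first exact: finite_finset.
rewrite -[X in measurable X]setTI.
suff mG : measurable_fun [set: E] (fun x : E => (G *m (x : V)) i 0 : R).
  by apply: mG => //; exact: measurable_itv.
rewrite (_ : (fun x : E => _) = fun x : E => \sum_j G i j * (x : V) j 0); last first.
  by apply/funext => x; rewrite mxE.
apply: measurable_sum => j; apply: measurable_funM => //.
by apply: continuous_measurable_euclid; exact: coord_continuous.
Qed.

(* Kronecker substitution: the morphism [digits N] from [Z^d] to [Z] separates
   any given finite set once [N] is large. *)
Let digits (N : nat) (z : Z) : int := \sum_(i < d) z i 0 * N%:Z ^+ i.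

Let digitsD N y z : digits N (y + z) = digits N y + digits N z.
Proof. by rewrite /digits -big_split; apply: eq_bigr => i _; rewrite mxE mulrDl. Qed.

Let cell_far (h : Z -> nat) (m : {finite_measure set E -> \bar R}) (e : R) : 0 < e ->
  exists n, fine (m [set x | (n <= h (cell x))%N]) < e.
Proof.
apply: fine_measure_small.
- move=> n; have := measurable_cell [set z | (n <= h z)%N] (fun _ => measurableT).
  by congr measurable; apply/seteqP; split => x /=; [case|].
- by move=> k l kl; apply/subsetPset => x /=; exact: leq_trans.
- by rewrite -subset0 => x /(_ (h (cell x)).+1 I) /=; rewrite ltnn.
Qed.

Section Uniqueness.
Variables (B : {fset Z}) (m m' : probability E R).
Hypothesis B0 : B != fset0.
Hypothesis mm' : forall f, bounded_continuous f ->
  \int[m]_x average (inv_image R A B) f x = \int[m']_x average (inv_image R A B) f x.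

Let translates_eq (U : set E) : measurable U ->
  \sum_(b <- B) (fine (m [set x | U ((x : V) + embed b)]) -
    fine (m' [set x | U ((x : V) + embed b)])) = 0.
Proof.
move=> mU; pose D := inv_image R A B.
have conv_eq f : bounded_continuous f ->
    \int[convolution m (delta_measure D)]_x f x = \int[convolution m' (delta_measure D)]_x f x.
  by move=> bf; rewrite !integral_convolution ?mm'//; exact: bounded_continuous_measurable.
have conv_indic (n : probability E R) : fine (convolution n (delta_measure D) U) =
    #|` D|%:R^-1 * \sum_(b <- B) fine (n [set x | U ((x : V) + embed b)]).
  have bU := @bounded_measurable_indic _ _ R _ mU.
  rewrite -Rintegral_indicT// integral_convolution// /average Rintegral_bmZ; last first.
    by apply: bounded_measurable_sum => a; exact: bounded_measurable_translation.
  rewrite Rintegral_bm_sum; last by move=> a; exact: bounded_measurable_translation.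
  rewrite sum_inv_image; congr (_ * _); apply: eq_bigr => b _.
  rewrite -Rintegral_indicT//.
  by rewrite -[X in measurable X]setTI; exact: measurable_translation.
have := bounded_continuous_determines conv_eq mU.
rewrite !conv_indic => /mulfI; rewrite sumrB => ->; first exact: subrr.
by rewrite invr_eq0 pnatr_eq0 card_inv_image cardfs_eq0.
Qed.

(** [x - embed (cell x)] is the position of [x] inside the fundamental domain, invariant under
    lattice translations; translating by [embed b] therefore only moves the index [k] by
    [digits N b]. *)
Let slice (N : nat) (F : set E) (k : int) : set E :=
  [set x | digits N (cell x) = k /\ F ((x : V) - embed (cell x))].

Let measurable_shift (F : set E) a : measurable F -> measurable [set x : E | F ((x : V) + a)].
Proof. by move=> mF; rewrite -[X in measurable X]setTI; exact: measurable_translation. Qed.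

Let measurable_slice N F k : measurable F -> measurable (slice N F k).
Proof.
move=> mF; apply: (measurable_cell [set z | digits N z = k]
  (W := fun z => [set x : E | F ((x : V) - embed z)])) => z.
exact: measurable_shift.
Qed.

(** As a function of [k], the difference of the two sides tends to 0 at both ends because the
    measures are finite, and its convolution with the digits of [B] is zero by [translates_eq]. *)
Let slice_eq N F k : measurable F -> fine (m (slice N F k)) = fine (m' (slice N F k)).
Proof.
move=> mF; apply/eqP; rewrite -subr_eq0; apply/eqP; move: k.
apply: (@vanishing_convolution R [seq digits N b | b <- B]).
- by apply: contra B0 => /eqP/(congr1 size)/=; rewrite size_map => /eqP; rewrite cardfs_eq0.
- move=> e e0; have e20 : 0 < e / 2 by lra.
  have [n mn] := cell_far (fun z => `|digits N z|%N) m e20.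
  have [n' mn'] := cell_far (fun z => `|digits N z|%N) m' e20.
  exists (n + n')%N => k nk.
  have sub (l : nat) (p : probability E R) : (l <= n + n')%N ->
      fine (p (slice N F k)) <= fine (p [set x | (l <= `|digits N (cell x)|)%N]).
    move=> ln; have ms : measurable [set x : E | (l <= `|digits N (cell x)|)%N].
      have := measurable_cell [set z | (l <= `|digits N z|)%N] (fun _ => measurableT).
      by congr measurable; apply/seteqP; split => x /=; [case|].
    rewrite fine_le ?fin_num_measure//; first exact: measurable_slice.
    apply: le_measure; rewrite ?inE//; first exact: measurable_slice.
    by move=> x [/= -> _]; lia.
  have := sub n m (leq_addr _ _); have := sub n' m' (leq_addl _ _).
  have : 0 <= fine (m (slice N F k)) by rewrite fine_ge0.
  have : 0 <= fine (m' (slice N F k)) by rewrite fine_ge0.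
  by rewrite ltr_norml => *; apply/andP; split; lra.
move=> k; rewrite big_map -[RHS](translates_eq (measurable_slice N k mF)).
apply: eq_bigr => b _.
suff -> : [set x | slice N F k ((x : V) + embed b)] = slice N F (k - digits N b) by [].
apply/seteqP; split => x; rewrite /slice/= cellD digitsD embedD opprD addrACA subrr addr0.
  by move=> [<- ?]; rewrite addrK.
by move=> [-> ?]; rewrite subrK.
Qed.

(** For large [n], the slice of index [digits n z] meets no cell near [z] other than [z] itself, by
    uniqueness of signed expansions in base [n]; the cells far from [z] carry little mass. *)
Let cell_eq (F : set E) z : measurable F ->
  fine (m [set x | cell x = z /\ F ((x : V) - embed (cell x))]) =
  fine (m' [set x | cell x = z /\ F ((x : V) - embed (cell x))]).
Proof.
move=> mF; pose S : set E := [set x | cell x = z /\ F ((x : V) - embed (cell x))].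
rewrite -/S.
have mS : measurable S.
  apply: (measurable_cell [set y | y = z]
    (W := fun z => [set x : E | F ((x : V) - embed z)])) => y.
  exact: measurable_shift.
pose h (y : Z) := (\max_(i < d) absz ((y - z)%R i ord0))%N.
have approx (p : probability E R) e : 0 < e -> exists n0, forall n, (n0 <= n)%N ->
    `|fine (p (slice n F (digits n z))) - fine (p S)| <= e.
  move=> e0; have [n0 pn0] := cell_far h p e0; exists n0 => n nn.
  have mT : measurable [set x : E | (n0 <= h (cell x))%N].
    have := measurable_cell [set y | (n0 <= h y)%N] (fun _ => measurableT).
    by congr measurable; apply/seteqP; split => x /=; [case|].
  have Ss : S `<=` slice n F (digits n z) by move=> x [xz Fx]; split => //=; rewrite xz.
  have msl := measurable_slice n (digits n z) mF.
  rewrite ger0_norm; last first.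
    rewrite subr_ge0 fine_le ?fin_num_measure//.
    by apply: le_measure; rewrite ?inE.
  pose T : set E := [set x | (n0 <= h (cell x))%N]; rewrite -/T in pn0 mT.
  rewrite lerBlDl (le_trans _ (lerD (lexx (fine (p S))) (ltW pn0)))//.
  rewrite -fineD ?fin_num_measure// fine_le ?fin_numD ?fin_num_measure//.
  apply: le_trans (measureU2 _ mS mT).
  apply: le_measure; rewrite ?inE//; first exact: measurableU.
  move=> x [/= xz Fx]; have [hx|hx] := leqP n0 (h (cell x)); first by right.
  suff xz' : cell x = z by left.
  have : digits n (cell x - z) = 0.
    by rewrite digitsD xz -digitsD subrr /digits big1// => i _; rewrite mxE mul0r.
  move=> /base_expansion_eq0 w0; apply/eqP; rewrite -subr_eq0; apply/eqP/matrixP => i j.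
  rewrite (ord1 j) w0 ?mxE// => {}i; rewrite (leq_ltn_trans _ (leq_trans hx nn))//.
  exact: leq_bigmax.
apply/eqP; rewrite -subr_eq0 -normr_le0; apply/ler_addgt0Pr => e e0; rewrite add0r.
have e20 : 0 < e / 2 by lra.
have [[n mn] [n' mn']] := (approx m _ e20, approx m' _ e20).
have := mn _ (leq_addr n' n); rewrite slice_eq// distrC => mS'.
rewrite [leRHS]splitr; set N := (n + n')%N in mS' *.
apply: (le_trans (ler_distD (fine (m' (slice N F (digits N z)))) _ _)).
exact: lerD mS' (mn' _ (leq_addl n n')).
Qed.

Let measure_eq_on_sets U : measurable U -> fine (m U) = fine (m' U).
Proof.
move=> mU; pose C z := [set x : E | cell x = z /\ U x].
have CE z : C z =
    [set x | cell x = z /\ [set y : E | U ((y : V) + embed z)] ((x : V) - embed (cell x))].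
  by apply/seteqP; split => x /= [xz]; rewrite xz subrK.
have mC z : measurable (C z) by apply: (measurable_cell [set y | y = z] (W := fun=> U)).
pose F (n : nat) := if @pickle_inv Z n is Some z then C z else set0.
have mF n : measurable (F n) by rewrite /F; case: pickle_inv.
have tF : trivIset setT F.
  move=> i j _ _ [x []]; rewrite /F; have := @pickle_invK Z i; have := @pickle_invK Z j.
  case: (pickle_inv i) => [y|//]; case: (pickle_inv j) => [z|//] /= <- <-.
  by move=> [<- _] [<- _].
have UE : U = \bigcup_n F n.
  apply/seteqP; split => [x Ux|x [n _]]; last by rewrite /F; case: pickle_inv => // z [].
  by exists (choice.pickle (cell x)) => //; rewrite /F pickleK_inv.
congr fine; rewrite UE !measure_semi_bigcup//; try by rewrite -UE.
apply: eq_eseriesr => n _; rewrite /F; case: pickle_inv => [z|]; last by rewrite !measure0.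
rewrite -[LHS]fineK ?fin_num_measure// -[RHS]fineK ?fin_num_measure//; congr EFin.
by rewrite CE cell_eq//; exact: measurable_shift.
Qed.

Lemma average_cancel (f : V -> R) : \int[m]_x f x = \int[m']_x f x.
Proof. exact: eq_Rintegral_measure measure_eq_on_sets. Qed.

End Uniqueness.

End Cancellation.

(** * Convergence of the tails *)

Section Deconvolution.
Variables (R : realType) (d : nat).
Local Notation V := 'cV[R]_d.
Local Notation E := (euclid R d).
Local Notation Z := 'cV[int]_d.

(** Compactness of [[- M, M]] yields a cluster point, and a cluster point of an ultrafilter is a
    limit. *)
Lemma ultrafilter_lim (U : set_system nat) (u : nat -> R) (M : R) :
  UltraFilter U -> (forall n, `|u n| <= M) -> cvg (u @ U).
Proof.
move=> UU uM.
have cM : compact `[- M, M]%classic by exact: segment_compact.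
have [|l [_ ul]] := cM (u @ U) _.
  suff : U (u @^-1` `[- M, M]%classic) by [].
  by apply: filterE => n; rewrite /= in_itv/= -ler_norml; exact: uM.
apply/cvg_ex; exists l => W Wl.
have [//|nW] := in_ultra_setVsetC (u @^-1` W) UU.
by have [x [nx Wx]] := ul (~` W) W nW Wl.
Qed.

(** The dominating measure for the ultrafilter limits: a pushforward under translation, multiplied
    by the number of points of the removed factor. *)
Lemma scaled_translated_measure (m : probability E R) (n : nat) (a : V) :
  exists p : {finite_measure set E -> \bar R}, forall f : V -> R,
    bounded_measurable (f : E -> R) -> (forall x, 0 <= f x) ->
    \int[p]_x f x = n%:R * \int[m]_x f ((x : V) + a).
Proof.
have mt := measurable_translation a.
pose k : {nonneg R} := NngNum (ler0n R n).
pose mu : {measure set E -> \bar R} := mscale k (giry_map mt m).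
have finmu : fin_num_fun mu.
  by move=> A mA; rewrite /mu/= /mscale fin_numM// (fin_num_measure (giry_map mt m)).
pose p : {finite_measure set E -> \bar R} :=
  HB.pack (mu : set E -> \bar R) (Measure.class mu) (Measure_isFinite.Build _ _ _ mu finmu).
exists p => f bf f0; have [mf _] := bf.
have mfE : measurable_fun [set: E] (EFin \o f) by exact/measurable_EFinP.
have -> : \int[p]_x f x = fine (n%:R%:E * \int[giry_map mt m]_x (f x)%:E)%E.
  by rewrite /Rintegral; congr fine; rewrite [LHS]ge0_integral_mscale// => x _; rewrite lee_fin.
have := giry_int_map mt m mfE (fun x => _ : (0%R <= (f x)%:E)%E).
rewrite /giry_int => ->; last by move=> x; rewrite lee_fin.
rewrite fineM//; apply: integrable_fin_num => //; apply: bounded_measurable_integrable.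
exact: bounded_measurable_translation.
Qed.

Definition positive_functional (L : (V -> R) -> R) :=
  [/\ linear_functional L, L (fun _ => 1) = 1 &
    forall f g, bounded_continuous f -> bounded_continuous g ->
      (forall x, f x <= g x) -> L f <= L g].

Lemma positive_functional_cst L c : positive_functional L -> L (fun _ => c) = c.
Proof.
move=> [linL L1 _]; have := linL.2 c _ (@bounded_continuous_cst R d 1).
by rewrite L1 !mulr1.
Qed.

Lemma positive_functional_norm_le L f c : positive_functional L ->
  bounded_continuous f -> (forall x, `|f x| <= c) -> `|L f| <= c.
Proof.
move=> pL bf fc; have [_ _ leL] := pL; rewrite ler_norml; apply/andP; split.
  rewrite -(positive_functional_cst (- c) pL); apply: leL => //.
    exact: bounded_continuous_cst.
  by move=> x; have := fc x; rewrite ler_norml => /andP[].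
rewrite -[leRHS](positive_functional_cst c pL); apply: leL => //.
  exact: bounded_continuous_cst.
by move=> x; have := fc x; rewrite ler_norml => /andP[].
Qed.

Section Limit.
Variables (A : 'M[int]_d) (B : {fset Z}) (T : nat -> (V -> R) -> R) (mu : probability E R).
Hypothesis A_unit : map_mx intr A \in unitmx (R := R).
Hypothesis B0 : B != fset0.
Hypothesis posT : forall n, positive_functional (T n).
Let D := inv_image R A B.
Hypothesis cvgT : forall f, bounded_continuous f ->
  T n (average D f) @[n --> \oo] --> \int[mu]_x f x.

Let D0 : D != fset0.
Proof. by rewrite -cardfs_eq0 card_inv_image// cardfs_eq0. Qed.

Section Ultra.
Variable U : set_system nat.
Hypothesis UU : UltraFilter U.
Hypothesis leU : \oo `<=` U.

Let L f := lim (T n f @[n --> U]).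

Let cvgL f : bounded_continuous f -> T n f @[n --> U] --> L f.
Proof.
move=> bf; have [_ [M fM]] := bf.
apply: (ultrafilter_lim (M := M)) => n.
exact: positive_functional_norm_le.
Qed.

Let cvg_oo_U (u : nat -> R) (l : R) : u n @[n --> \oo] --> l -> u n @[n --> U] --> l.
Proof. by move=> ul W /ul /leU. Qed.

Let linL : linear_functional L.
Proof.
split=> [f g bf bg|c f bf].
  rewrite /L (_ : (fun n => _) = (fun n => T n f + T n g)); last first.
    by apply/funext => n; have [[-> //]] := posT n.
  by apply: (@cvg_lim _ (@Rhausdorff R)); apply: cvgD; exact: cvgL.
rewrite /L (_ : (fun n => _) = (fun n => c * T n f)); last first.
  by apply/funext => n; have [[_ -> //]] := posT n.
by apply: (@cvg_lim _ (@Rhausdorff R)); apply: cvgMr; exact: cvgL.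
Qed.

Let L1 : L (fun _ => 1) = 1.
Proof.
apply: (@cvg_lim _ (@Rhausdorff R)); apply: cvg_near_cst; apply: nearW => n.
by have [_ ->] := posT n.
Qed.

(* [f <= #D * average D (f (_ - a))] when [f >= 0], so every limit of the [T n]
   is dominated by a multiple of a translate of [mu]. *)
Let domL (e : R) : 0 < e -> exists m : {finite_measure set E -> \bar R},
  forall f, bounded_continuous f -> (forall x, f x <= 1) ->
    L f <= \int[m]_x Num.max (f x) 0 + e.
Proof.
move=> e0; have [a aD] : exists a, a \in D by exact/fset0Pn.
have [m mE] := scaled_translated_measure mu #|` D| (- a).
exists m => f bf _.
pose g x := Num.max (f x) 0.
have g0 x : 0 <= g x by rewrite le_max lexx orbT.
have bg : bounded_continuous g.
    by apply: bounded_continuous_max => //; exact: bounded_continuous_cst.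
apply: (@le_trans _ _ (\int[m]_x g x)); last by rewrite lerDl ltW.
rewrite mE//; last exact: bounded_continuous_measurable.
pose h x := g (x - a).
have bh : bounded_continuous h by exact: bounded_continuous_translation.
have cvgh : #|` D|%:R * T n (average D h) @[n --> U] --> #|` D|%:R * \int[mu]_x h x.
  by apply: cvgMr; apply: cvg_oo_U; exact: cvgT.
apply: (ler_cvg_to (cvgL bf) cvgh); apply: nearW => n.
have [[_ TZ] _ Tle] := posT n.
rewrite -TZ; last exact: bounded_continuous_average.
apply: Tle => //; first by apply: bounded_continuousZ; exact: bounded_continuous_average.
move=> x; rewrite /average mulrA divff ?mul1r ?pnatr_eq0 ?cardfs_eq0//.
rewrite (big_fsetD1 a)//= /h addrK (le_trans (_ : f x <= g x))//.
  by rewrite le_max lexx.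
by rewrite lerDl sumr_ge0.
Qed.

Lemma ultrafilter_limit_measure : exists m : probability E R,
  (forall f, bounded_continuous f -> T n f @[n --> U] --> \int[m]_x f x) /\
  (forall f, bounded_continuous f -> \int[m]_x average D f x = \int[mu]_x f x).
Proof.
have [m mL] := functional_representation linL L1 domL.
exists m; split=> f bf; first by rewrite -mL//; exact: cvgL.
rewrite -mL; last exact: bounded_continuous_average.
by apply: (@cvg_lim _ (@Rhausdorff R)); apply: cvg_oo_U; exact: cvgT.
Qed.

End Ultra.

(** All ultrafilter limits solve the same equation with the factor [D], so cancellation makes them
    agree, and agreement of all ultrafilter limits is convergence. *)
Lemma deconvolution : exists m : probability E R,
  forall f, bounded_continuous f -> T n f @[n --> \oo] --> \int[m]_x f x.
Proof.
have [U [UU leU]] := ultraFilterLemma (eventually_filter).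
have [m [_ mm]] := ultrafilter_limit_measure UU leU.
exists m => f bf; apply/cvgrPdist_lt => e e0; apply: contrapT => far.
pose S := [set n | ~ (`|\int[m]_x f x - T n f| < e)].
(* The bad indices [S] meet every neighbourhood of infinity, so some ultrafilter finer than [\oo]
   contains [S]; its limit is the contradiction. *)
have FF : ProperFilter (within S \oo).
  apply: Build_ProperFilter; rewrite /within/= => nS; apply: far.
  by move: nS; apply: filterS => n /contrapT.
have [U' [UU' leU']] := ultraFilterLemma FF.
have leU'oo : \oo `<=` U' by move=> W oW; apply: leU'; apply: filterS oW => n Wn.
have [m' [cvgm' mm']] := ultrafilter_limit_measure UU' leU'oo.
have mm'f : \int[m]_x f x = \int[m']_x f x.
  by apply: (average_cancel A_unit B0) => g bg; rewrite mm// mm'.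
have /cvgrPdist_lt/(_ e e0) := cvgm' f bf; rewrite -mm'f => near_e.
have US : U' S by apply: leU'; rewrite /within/=; exact: nearW.
by have [n [? []]] := @filter_ex _ U' _ _ (@filterI _ U' _ _ _ near_e US).
Qed.

End Limit.

End Deconvolution.

(** * Transfer between equivalent sequences *)

Lemma cvg_addn (R : realType) (u : nat -> R) (l : R) (m : nat) :
  u n @[n --> \oo] --> l -> u (m + n)%N @[n --> \oo] --> l.
Proof.
move=> ul W /ul[N _ NW]; exists N => // n /= Nn; apply: NW => /=.
exact: leq_trans Nn (leq_addl _ _).
Qed.

Section IteratedAverages.
Variables (R : realType) (d : nat).
Local Notation V := 'cV[R]_d.
Local Notation E := (euclid R d).
Implicit Types (A : nat -> {fset V}) (D : {fset V}) (f : V -> R).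

(** The integral of [f (x + _)] against the convolution of the first [n] uniform measures. The last
    factor is peeled off first, as in [partial_convolution], but [n = 0] is the empty
    convolution. *)
Fixpoint averages A n f : V -> R :=
  if n is k.+1 then averages A k (average (A k) f) else f.

Lemma bounded_continuous_averages A n f :
  bounded_continuous f -> bounded_continuous (averages A n f).
Proof.
by elim: n f => //= n ih f bf; apply: ih; exact: bounded_continuous_average.
Qed.

Lemma averages_average A n D f :
  averages A n (average D f) = average D (averages A n f).
Proof.
elim: n f => //= n ih f; rewrite -ih; congr averages.
by apply/funext => x; exact: averageC.
Qed.

Lemma averages_averages A B m n f :
  averages A m (averages B n f) = averages B n (averages A m f).
Proof. by elim: n f => //= n ih f; rewrite ih averages_average. Qed.

Lemma averages_add A m n f :
  averages A (m + n) f = averages A m (averages (Defs.shift m A) n f).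
Proof.
elim: n f => [|n ih] f; first by rewrite addn0.
by rewrite addnS /= ih.
Qed.

Lemma positive_functional_averages A n x : (forall k, A k != fset0) ->
  positive_functional (fun f => averages A n f x).
Proof.
move=> A0; elim: n => [|n [[ihD ihZ] ih1 ihle]]; first by split => //.
split=> [||f g bf bg fg] /=.
- split=> [f g bf bg|c f bf] /=.
    rewrite -ihD; try exact: bounded_continuous_average.
    by congr averages; apply/funext => y; rewrite averageD.
  rewrite -ihZ; last exact: bounded_continuous_average.
  by congr averages; apply/funext => y; rewrite averageZ.
- rewrite -[RHS]ih1; congr averages; apply/funext => y; exact: average_cst.
- apply: ihle; try exact: bounded_continuous_average.
  by move=> y; exact: average_le.
Qed.

Lemma averages_norm_le A n f c x : (forall k, A k != fset0) ->
  bounded_continuous f -> (forall y, `|f y| <= c) -> `|averages A n f x| <= c.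
Proof.
by move=> A0; exact: positive_functional_norm_le (positive_functional_averages n x A0).
Qed.

(* [e k] bounds the total variation distance of [delta_(A k)] and [delta_(A' k)]. *)
Definition average_close (e : nat -> R) A A' :=
  forall k f c, (forall y, `|f y| <= c) ->
    forall x, `|average (A k) f x - average (A' k) f x| <= c * e k.

(** The factors are exchanged one at a time; the other averages are contractions, so each exchange
    costs only [c * e k]. *)
Lemma averages_close e A A' n f c x :
  (forall k, A k != fset0) -> (forall k, A' k != fset0) ->
  average_close e A A' -> bounded_continuous f -> (forall y, `|f y| <= c) ->
  `|averages A n f x - averages A' n f x| <= c * \sum_(k < n) e k.
Proof.
move=> A0 A'0 cl; elim: n f => [|n ih] f bf fc; first by rewrite subrr normr0 big_ord0 mulr0.
rewrite big_ord_recr/= mulrDr [leRHS]addrC.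
have c0 : 0 <= c by rewrite (le_trans _ (fc x)).
have bA := bounded_continuous_average (A n) bf.
have bA' := bounded_continuous_average (A' n) bf.
rewrite (le_trans (ler_distD (averages A n (average (A' n) f) x) _ _))// lerD//; last first.
  by apply: ih => // y; exact: average_norm_le.
have [linA _ _] := positive_functional_averages n x A0.
rewrite -(linear_functionalB linA bA bA').
apply: averages_norm_le => // [|y]; first exact: bounded_continuousB.
exact: cl.
Qed.

Definition averages_cvg A (m : probability E R) := forall f,
  bounded_continuous f -> averages A n f 0 @[n --> \oo] --> \int[m]_x f x.

(** Summability of a nonnegative [e], in Cauchy form with finite sums only. *)
Definition tails_vanish (e : nat -> R) :=
  forall r : R, 0 < r -> exists m, forall n, \sum_(k < n) e (m + k)%N <= r.

Section Transfer.
Variables (A A' : nat -> {fset V}) (e : nat -> R).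
Variables (P : nat -> 'M[int]_d) (B : nat -> {fset 'cV[int]_d}).
Hypothesis P_unit : forall k, map_mx intr (P k) \in unitmx (R := R).
Hypothesis AE : forall k, A k = inv_image R (P k) (B k).
Hypothesis B0 : forall k, B k != fset0.
Hypothesis A'0 : forall k, A' k != fset0.
Hypothesis AA' : average_close e A A'.
Hypothesis e_tails : tails_vanish e.

Let A0 k : A k != fset0.
Proof. by rewrite AE -cardfs_eq0 card_inv_image// cardfs_eq0. Qed.

(** Induction on [m], each step removing the leading factor [A m] by [deconvolution]. *)
Lemma averages_tail_cvg mu m : averages_cvg A mu ->
  exists m' : probability E R, averages_cvg (Defs.shift m A) m'.
Proof.
move=> cA; elim: m => [|m [nu cnu]]; first by exists mu.
pose T n f := averages (Defs.shift m.+1 A) n f 0.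
apply: (@deconvolution R d (P m) (B m) T nu (P_unit m) (B0 m)) => [n|f bf].
  by apply: positive_functional_averages => k; exact: A0.
have TE n : T n (average (inv_image R (P m) (B m)) f) = averages (Defs.shift m A) n.+1 f 0.
  rewrite /T averages_average -AE -(addn1 n) addnC averages_add/=.
  by rewrite /Defs.shift addn0; congr (average _ (averages _ _ _) _);
    apply/funext => i; congr A; lia.
rewrite (_ : (fun n => _) = fun n => averages (Defs.shift m A) (1 + n) f 0).
  exact: (cvg_addn 1 (cnu f bf)).
by apply/funext => n; rewrite TE.
Qed.

Let convolve m (p : subprobability E R) : exists q : subprobability E R,
  forall f, bounded_continuous f -> \int[q]_x f x = \int[p]_x averages A' m f x.
Proof.
elim: m => [|m [q qE]]; first by exists p.
exists (convolution q (delta_measure (A' m))) => f bf.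
rewrite integral_convolution; last exact: bounded_continuous_measurable.
by rewrite qE//; exact: bounded_continuous_average.
Qed.

Lemma averages_cvg_transfer mu : averages_cvg A mu ->
  exists mu' : probability E R, averages_cvg A' mu'.
Proof.
move=> cA; pose u f n := averages A' n f 0.
have posu n : positive_functional (u^~ n) by exact: positive_functional_averages.
(* [q] is the hybrid measure, with the first [m] factors from [A'] and the tail from [A]; [v] is the
   sequence of integrals against its partial convolutions. *)
have approx m : exists q : subprobability E R, forall f c, bounded_continuous f ->
    (forall x, `|f x| <= c) -> exists v : nat -> R, v n @[n --> \oo] --> \int[q]_x f x /\
    forall n, `|u f (m + n)%N - v n| <= c * \sum_(k < n) e (m + k)%N.
  have [p cp] := averages_tail_cvg m cA; have [q qE] := convolve m p.
  exists q => f c bf fc; exists (fun n => averages (Defs.shift m A) n (averages A' m f) 0).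
  split=> [|n]; first by rewrite qE//; apply: cp; exact: bounded_continuous_averages.
  (* Commuting the operators puts the common averages over [A'] innermost, so that only the two
     tails act differently, on the same function. *)
  rewrite /u averages_add averages_averages distrC.
  apply: (@averages_close (Defs.shift m e)) => [k|k|k||y];
    try exact: bounded_continuous_averages.
  - exact: A0.
  - exact: A'0.
  - exact: AA'.
  - exact: averages_norm_le.
have cvgu f : bounded_continuous f -> cvg (u f n @[n --> \oo]).
  move=> bf; have [_ [M fM]] := bf; apply/cauchy_cvgP/cauchy_exP => r r0.
  have M0 : 0 <= M by rewrite (le_trans _ (fM 0)).
  (* [M + 1] instead of [M], because [M] may be 0. *)
  have s0 : 0 < r / (2 * (M + 1)) by rewrite divr_gt0// mulr_gt0// ltr_wpDl.
  have [m em] := e_tails s0; have [q /(_ f M bf fM)[v [vq uv]]] := approx m.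
  exists (\int[q]_x f x); have r20 : 0 < r / 2 by rewrite divr_gt0.
  have /cvgrPdist_lt/(_ _ r20)[N _ vN] := vq.
  exists (m + N)%N => // n /= mn; rewrite -ball_normE/=.
  have nE : n = (m + (n - m))%N by rewrite subnKC// (leq_trans _ mn)// leq_addr.
  have Nn : (N <= n - m)%N by lia.
  have {}vN := vN _ Nn; have {}uv := uv (n - m)%N; rewrite -nE in uv.
  rewrite (le_lt_trans (ler_distD (v (n - m)%N) _ _))// [ltRHS]splitr ltr_leD//.
  rewrite distrC (le_trans uv)// (le_trans (ler_wpM2l M0 (em _)))//.
  rewrite mulrCA ler_pM2l// invfM mulrA ler_pdivrMr ?ltr_wpDl//.
  lra.
pose L f := lim (u f n @[n --> \oo]).
have cvgL f : bounded_continuous f -> u f n @[n --> \oo] --> L f by exact: cvgu.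
have linL : linear_functional L.
  split=> [f g bf bg|c f bf].
    rewrite /L (_ : (fun n => _) = (fun n => u f n + u g n)); last first.
      by apply/funext => n; have [[-> //]] := posu n.
    by apply: (@cvg_lim _ (@Rhausdorff R)); apply: cvgD; exact: cvgL.
  rewrite /L (_ : (fun n => _) = (fun n => c * u f n)); last first.
    by apply/funext => n; have [[_ -> //]] := posu n.
  by apply: (@cvg_lim _ (@Rhausdorff R)); apply: cvgMr; exact: cvgL.
have L1 : L (fun _ => 1) = 1.
  apply: (@cvg_lim _ (@Rhausdorff R)); apply: cvg_near_cst; apply: nearW => n.
  by have [_ ->] := posu n.
have [r r0|mu' mu'E] := functional_representation linL L1.
  have [m em] := e_tails r0; have [q qv] := approx m.
  (* Only the upper bound 1 on [f] is uniform; its positive part is bounded by 1 in absolute value,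
     so the tail error [r] does not depend on [f]. *)
  exists q => f bf f1; pose g x := Num.max (f x) 0.
  have bg : bounded_continuous g.
    by apply: bounded_continuous_max => //; exact: bounded_continuous_cst.
  have g1 x : `|g x| <= 1.
    by rewrite ger0_norm ?le_max ?lexx ?orbT// ge_max f1 ler01.
  have [v [vq uv]] := qv g 1 bg g1.
  have vqr : v n + r @[n --> \oo] --> \int[q]_x g x + r by apply: cvgD => //; exact: cvg_cst.
  apply: (ler_cvg_to (cvg_addn m (cvgL f bf)) vqr); apply: nearW => n.
  have fg : u f (m + n)%N <= u g (m + n)%N.
    by have [_ _] := posu (m + n)%N; apply => // x; rewrite le_max lexx.
  rewrite (le_trans fg)// -lerBlDl (le_trans (ler_norm _))// (le_trans (uv n))//.
  by rewrite mul1r em.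
by exists mu' => f bf; rewrite -mu'E//; exact: cvgL.
Qed.

End Transfer.

End IteratedAverages.

(** * Infinite convolutions *)

Section InfiniteConvolutions.
Variables (R : realType) (d : nat).
Local Notation V := 'cV[R]_d.
Local Notation E := (euclid R d).
Local Notation Z := 'cV[int]_d.
Implicit Types (M : nat -> 'M[int]_d) (B : nat -> {fset Z}).

(** A zero determinant would make 0 an eigenvalue. *)
Lemma expansive_unitmx (A : 'M[int]_d) :
  expansive R A -> map_mx intr A \in unitmx (R := R).
Proof.
move=> expA; rewrite unitmxE unitfE det_map_mx intr_eq0; apply/negP => /eqP detA.
have : \det (map_mx intr A : 'M[R[i]]_d) == 0 by rewrite det_map_mx detA.
move=> /det0P[v v0 vA]; have : eigenvalue (map_mx (intmul (1 : R[i])) A) 0.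
  by apply/eigenvalueP; exists v => //; rewrite scale0r.
by move=> /expA; rewrite normr0 ltr10.
Qed.

Lemma mxprod_unitmx M n : (forall k, map_mx intr (M k) \in unitmx (R := R)) ->
  map_mx intr (mxprod M n) \in unitmx (R := R).
Proof.
by move=> uM; elim: n => [|n ih] /=; rewrite ?map_mxM ?unitmx_mul ?uM.
Qed.

Definition digit_sets M B k : {fset V} := inv_image R (mxprod M k) (B k).

Lemma integral_partial_convolution M B n (f : V -> R) : bounded_continuous f ->
  \int[partial_convolution R M B n]_x f x = averages (digit_sets M B) n.+1 f 0.
Proof.
elim: n f => [|n ih] f bf /=.
  by rewrite integral_delta_measure//; exact: bounded_continuous_measurable.
rewrite integral_convolution; last exact: bounded_continuous_measurable.
by rewrite ih//; exact: bounded_continuous_average.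
Qed.

Lemma infinite_convolutionP M B (m : probability E R) :
  is_infinite_convolution M B m <-> averages_cvg (digit_sets M B) m.
Proof.
split=> [cm f bf|cm f cf bf]; last first.
  under eq_fun do rewrite integral_partial_convolution//.
  (* [partial_convolution] at index [n] has [n.+1] factors, hence the shift by one in both
     directions. *)
  exact: (cvg_addn 1 (cm f (conj cf bf))).
have [cf [c fc]] := bf; move=> W /(cm f cf (ex_intro _ c fc))[N _ NW].
exists N.+1 => // -[//|n] /= Nn; have := NW n Nn.
by rewrite /= integral_partial_convolution.
Qed.

(** * Distance between uniform measures on finite sets *)

Definition set_distance (B B' : {fset Z}) : R :=
  #|` (B' `\` B)%fset |%:R / #|` B' |%:R + #|` (B `\` B')%fset |%:R / #|` B |%:R.

Lemma set_distance_ge0 (B B' : {fset Z}) : 0 <= set_distance B B'.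
Proof. by rewrite addr_ge0// divr_ge0. Qed.

Lemma set_distanceC (B B' : {fset Z}) : set_distance B B' = set_distance B' B.
Proof. by rewrite /set_distance addrC. Qed.

(** The factor 2 has two sources. On the intersection the weights differ in total by
    [|#(B' \ B)/#B' - #(B \ B')/#B|], at most one [set_distance]; the two set differences together
    contribute another. *)
Lemma average_set_distance (B B' : {fset Z}) (F : Z -> R) (c : R) :
  B != fset0 -> B' != fset0 -> (forall b, `|F b| <= c) ->
  `|#|` B|%:R^-1 * \sum_(b <- B) F b - #|` B'|%:R^-1 * \sum_(b <- B') F b| <=
  c * (2 * set_distance B B').
Proof.
move=> B0 B'0 Fc.
have sum_le (D : {fset Z}) : `|\sum_(b <- D) F b| <= c * #|` D|%:R.
  rewrite (le_trans (ler_norm_sum _ _ _))//.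
  rewrite (le_trans (ler_sum _ (fun b _ => Fc b)))//.
  by rewrite big_const_seq count_predT iter_addr_0 mulr_natr.
have split_sum (C D : {fset Z}) :
    \sum_(b <- C) F b = \sum_(b <- (C `&` D)%fset) F b + \sum_(b <- (C `\` D)%fset) F b.
  rewrite (big_fsetID _ (mem D))/=; congr (_ + _); congr (\sum_(b <- _) _).
    by apply: congr1; apply/fsetP => x; rewrite !inE.
  by apply: congr1; apply/fsetP => x; rewrite !inE andbC.
rewrite (split_sum B B') (split_sum B' B) fsetIC /set_distance.
have cB : #|` B|%:R = #|` (B' `&` B)%fset|%:R + #|` (B `\` B')%fset|%:R :> R.
  by rewrite -natrD fsetIC cardfsID.
have cB' : #|` B'|%:R = #|` (B' `&` B)%fset|%:R + #|` (B' `\` B)%fset|%:R :> R.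
  by rewrite -natrD cardfsID.
have p0 : 0 < #|` B|%:R :> R by rewrite ltr0n cardfs_gt0.
have p'0 : 0 < #|` B'|%:R :> R by rewrite ltr0n cardfs_gt0.
have c0 : 0 <= c by rewrite (le_trans _ (Fc 0)).
have ic : (#|` B|%:R^-1 - #|` B'|%:R^-1) * #|` (B' `&` B)%fset|%:R =
    #|` (B' `\` B)%fset|%:R / #|` B'|%:R - #|` (B `\` B')%fset|%:R / #|` B|%:R :> R.
  rewrite mulrBl; have -> : #|` (B' `&` B)%fset|%:R = #|` B|%:R - #|` (B `\` B')%fset|%:R :> R.
    by rewrite cB addrK.
  rewrite {2}(_ : #|` B|%:R - _ = #|` B'|%:R - #|` (B' `\` B)%fset|%:R);
    last by rewrite cB cB' !addrK.
  by rewrite !mulrBr !mulVf ?lt0r_neq0//; lra.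
have := sum_le (B' `&` B)%fset; have := sum_le (B `\` B')%fset; have := sum_le (B' `\` B)%fset.
move: (\sum_(b <- _) _) (\sum_(b <- _) _) (\sum_(b <- _) _) => C X Y Ys' Xs Ci.
rewrite (_ : _ - _ = (#|` B|%:R^-1 - #|` B'|%:R^-1) * C + #|` B|%:R^-1 * X -
  #|` B'|%:R^-1 * Y); last by lra.
have sp0 : 0 <= #|` (B `\` B')%fset|%:R / #|` B|%:R :> R by rewrite divr_ge0.
have sp'0 : 0 <= #|` (B' `\` B)%fset|%:R / #|` B'|%:R :> R by rewrite divr_ge0.
rewrite (le_trans (ler_normB _ _))// (le_trans (lerD (ler_normD _ _) (lexx _)))//.
rewrite !normrM !(@ger0_norm _ _^-1) ?invr_ge0//.
have h1 : `|#|` B|%:R^-1 - #|` B'|%:R^-1| * `|C| <=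
    c * (#|` (B' `\` B)%fset|%:R / #|` B'|%:R + #|` (B `\` B')%fset|%:R / #|` B|%:R).
  rewrite (le_trans (ler_wpM2l _ Ci))// mulrCA ler_wpM2l//.
  rewrite -[X in _ * X <= _](@ger0_norm _ #|` (B' `&` B)%fset|%:R)// -normrM ic.
  by rewrite (le_trans (ler_normB _ _))// !ger0_norm.
have h2 : #|` B|%:R^-1 * `|X| <= c * (#|` (B `\` B')%fset|%:R / #|` B|%:R).
  by rewrite ler_pdivrMl// mulrCA [_ * (_ / _)]mulrC divfK ?lt0r_neq0.
have h3 : #|` B'|%:R^-1 * `|Y| <= c * (#|` (B' `\` B)%fset|%:R / #|` B'|%:R).
  by rewrite ler_pdivrMl// mulrCA [_ * (_ / _)]mulrC divfK ?lt0r_neq0.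
by rewrite (le_trans (lerD (lerD h1 h2) h3))//; lra.
Qed.

Lemma average_close_digit_sets M B B' :
  (forall k, map_mx intr (M k) \in unitmx (R := R)) ->
  (forall k, B k != fset0) -> (forall k, B' k != fset0) ->
  average_close (fun k => 2 * set_distance (B k) (B' k)) (digit_sets M B) (digit_sets M B').
Proof.
move=> uM B0 B'0 k f c fc x; have uP := mxprod_unitmx k uM.
rewrite /average /digit_sets !card_inv_image// !sum_inv_image//.
exact: average_set_distance.
Qed.

Lemma equivalent_seq_tails B B' : equivalent_seq R B B' ->
  tails_vanish (fun k => 2 * set_distance (B k) (B' k)).
Proof.
move=> BB' r r0; have r20 : 0 < r / 2 by lra.
pose t k : \bar R := (set_distance (B k) (B' k))%:E.
have t0 k : (0 <= t k)%E by rewrite lee_fin set_distance_ge0.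
have /fine_cvgP[[N1 _ fin1] /cvgr0Pnorm_lt/(_ _ r20)[N2 _ small]] :=
  @nneseries_tail_cvg R t xpredT BB' (fun k _ => t0 k).
exists (N1 + N2)%N => n; have /= := fin1 (N1 + N2)%N (leq_addr _ _).
have /= := small (N1 + N2)%N (leq_addl _ _); set N := (N1 + N2)%N => sN fN.
rewrite -mulr_sumr -ler_pdivlMl// mulrC.
rewrite (le_trans _ (le_trans (ler_norm _) (ltW sN)))// -lee_fin fineK//.
rewrite (le_trans _ (@nneseries_lim_ge R t xpredT N (N + n)%N (fun k _ _ => t0 k)))//.
suff -> : (\sum_(N <= i < N + n) t i)%R =
    (\sum_(i < n) set_distance (B (N + i)%N) (B' (N + i)%N))%:E by [].
rewrite -{1}[N]add0n big_addn addKn big_mkord -sumEFin.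
by apply: eq_bigr => i _; rewrite addnC.
Qed.

Lemma tail_sum_le (e : nat -> R) m p n : (forall k, 0 <= e k) ->
  \sum_(k < n) e (m + p + k)%N <= \sum_(k < p + n) e (m + k)%N.
Proof.
move=> e0; rewrite big_split_ord/= (eq_bigr (fun k : 'I_n => e (m + (p + k))%N)).
  by rewrite lerDr sumr_ge0.
by move=> k _; rewrite addnA.
Qed.

Lemma tails_vanish_shift (e : nat -> R) m : (forall k, 0 <= e k) ->
  tails_vanish e -> tails_vanish (Defs.shift m e).
Proof.
move=> e0 te r /te[N eN]; exists N => n.
apply: le_trans (le_trans (tail_sum_le N m n e0) (eN _)).
by apply: ler_sum => k _; rewrite /Defs.shift addnA (addnC m).
Qed.

Lemma infinite_convolution_transfer M B B' (mu : probability E R) :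
  (forall k, expansive R (M k)) ->
  (forall k, B k != fset0) -> (forall k, B' k != fset0) ->
  tails_vanish (fun k => 2 * set_distance (B k) (B' k)) ->
  is_infinite_convolution M B mu ->
  exists mu' : probability E R, is_infinite_convolution M B' mu'.
Proof.
move=> expM B0 B'0 tBB' /infinite_convolutionP cmu.
have uM k := expansive_unitmx (expM k).
have [|mu' cmu'] := averages_cvg_transfer (fun k => mxprod_unitmx k uM) (fun=> erefl) B0 _
  (average_close_digit_sets uM B0 B'0) tBB' cmu.
  move=> k; rewrite -cardfs_eq0 card_inv_image ?cardfs_eq0//; exact: mxprod_unitmx.
by exists mu'; apply/infinite_convolutionP.
Qed.

Lemma infinite_convolution_close M B B' (mu mu' : probability E R) (r : R) f :
  (forall k, expansive R (M k)) ->
  (forall k, B k != fset0) -> (forall k, B' k != fset0) ->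
  (forall n, \sum_(k < n) 2 * set_distance (B k) (B' k) <= r) ->
  is_infinite_convolution M B mu -> is_infinite_convolution M B' mu' ->
  continuous f -> (forall x, `|f x| <= 1) ->
  `|\int[mu]_x f x - \int[mu']_x f x| <= r.
Proof.
move=> expM B0 B'0 sr /infinite_convolutionP cmu /infinite_convolutionP cmu' cf f1.
have bf : bounded_continuous f by split => //; exists 1.
have uM k := expansive_unitmx (expM k).
have D0 (C : nat -> {fset Z}) : (forall k, C k != fset0) -> forall k, digit_sets M C k != fset0.
  by move=> C0 k; rewrite -cardfs_eq0 card_inv_image ?cardfs_eq0//; exact: mxprod_unitmx.
have cl := average_close_digit_sets uM B0 B'0.
apply: (ler_cvg_to (cvg_norm (cvgB (cmu f bf) (cmu' f bf))) (cvg_cst r)).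
apply: nearW => n; have := averages_close n 0 (D0 _ B0) (D0 _ B'0) cl bf f1.
by rewrite mul1r => /le_trans; apply; exact: sr.
Qed.

(** * Fourier transforms and equi-positivity *)

Lemma continuous_dotmul (xi : V) : continuous (dotmul xi).
Proof.
suff cs (s : seq 'I_d) : continuous (fun x : V => \sum_(i <- s) xi i 0 * x i 0) by exact: cs.
elim: s => [|i s ih].
  under eq_fun do rewrite big_nil; exact: cst_continuous.
have ci : continuous (fun x : V => xi i 0 * x i 0).
  by move=> x; apply: continuousM; [exact: cst_continuous|exact: coord_continuous].
by under eq_fun do rewrite big_cons; move=> x; exact: continuousD (ci x) (ih x).
Qed.

(** The real and imaginary parts integrate a cosine and a sine, each bounded by 1, so each moves by
    at most [r]; the modulus moves by at most [sqrt 2 * r], rounded up to [2 * r]. *)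
Lemma fourier_close (mu mu' : probability E R) (r : R) (xi : V) :
  (forall f, continuous f -> (forall x, `|f x| <= 1) ->
    `|\int[mu]_x f x - \int[mu']_x f x| <= r) ->
  `|fourier mu xi - fourier mu' xi| <= (2 * r)%:C%C.
Proof.
move=> close.
have ct : continuous (fun x : V => - (2 * pi * dotmul xi x)).
  have cM : continuous (fun x : V => 2 * pi * dotmul xi x).
    by move=> x; exact: continuousM
      (@cst_continuous _ _ (2 * pi : R) x) (@continuous_dotmul xi x).
  by move=> x; exact: continuousN (cM x).
have ccos : continuous (fun x : V => cos (- (2 * pi * dotmul xi x))).
  by move=> x; apply: continuous_comp; [exact: ct|exact: continuous_cos].
have csin : continuous (fun x : V => sin (- (2 * pi * dotmul xi x))).
  by move=> x; apply: continuous_comp; [exact: ct|exact: continuous_sin].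
have hc : `|\int[mu]_x cos (- (2 * pi * dotmul xi x)) -
    \int[mu']_x cos (- (2 * pi * dotmul xi x))| <= r.
  by apply: close => // x; rewrite ler_norml cos_geN1 cos_le1.
have hs : `|\int[mu]_x sin (- (2 * pi * dotmul xi x)) -
    \int[mu']_x sin (- (2 * pi * dotmul xi x))| <= r.
  by apply: close => // x; rewrite ler_norml sin_geN1 sin_le1.
rewrite /fourier normc_def lecR/=.
have sqrt_le (a b : R) : `|a| <= r -> `|b| <= r -> Num.sqrt (a ^+ 2 + b ^+ 2) <= 2 * r.
  move=> ar br; have r0 : 0 <= r by rewrite (le_trans _ ar).
  rewrite -[leRHS]ger0_norm ?mulr_ge0// -sqrtr_sqr ler_sqrt ?sqr_ge0//.
  rewrite -(real_normK (num_real a)) -(real_normK (num_real b)).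
  have a2 : `|a| ^+ 2 <= r ^+ 2 by rewrite ler_sqr ?nnegrE.
  have b2 : `|b| ^+ 2 <= r ^+ 2 by rewrite ler_sqr ?nnegrE.
  by rewrite exprMn; have := sqr_ge0 r; lra.
exact: sqrt_le.
Qed.

Lemma equi_positive_transfer M B B' (mu mu' : probability E R) :
  (forall k, expansive R (M k)) ->
  (forall k, B k != fset0) -> (forall k, B' k != fset0) ->
  tails_vanish (fun k => 2 * set_distance (B k) (B' k)) ->
  is_infinite_convolution M B' mu' ->
  equi_positive_measure M B mu -> equi_positive_measure M B' mu'.
Proof.
move=> expM B0 B'0 tBB' cmu' [cmu [n [nu [nincr n1 cnu [eps [dlt [eps0 dlt0 epos]]]]]]].
split => //; pose e k : R := 2 * set_distance (B k) (B' k).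
have e0 k : 0 <= e k by rewrite mulr_ge0// set_distance_ge0.
(* In a shifted sequence the matrix products start afresh, so its digit sets are not shifts of the
   original ones; the transfer is applied anew to each shifted pair. *)
have ex_nu j : exists nu' : probability E R,
    is_infinite_convolution (Defs.shift (n j) M) (Defs.shift (n j) B') nu'.
  apply: infinite_convolution_transfer (cnu j) => [k|k|k|]; [exact: expM|exact: B0|exact: B'0|].
  exact: (@tails_vanish_shift e (n j) e0 tBB').
have [nu' cnu'] := choice ex_nu.
(* [fourier_close] doubles the error, so a tail below [eps / 4] leaves the lower bound [eps / 2]. *)
have r0 : 0 < eps / 4 by lra.
have [m em] := tBB' _ r0.
(* A strictly increasing [n] satisfies [j <= n j]; dropping the first [m] terms of the subsequence
   makes every shift at least [m]. *)
have nm j : (m <= n (m + j))%N.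
  have nj i : (i <= n i)%N by elim: i => // i ih; rewrite (leq_ltn_trans ih)// nincr.
  by rewrite (leq_trans _ (nj _))// leq_addr.
exists (fun j => n (m + j)%N), (fun j => nu' (m + j)%N); split => //.
- by move=> i j ij; apply: nincr; rewrite ltn_add2l.
- exists (eps / 2), dlt; split => //; first by lra.
  move=> x xbox _ [j _ <-].
  have [k [k0 kP]] := epos x xbox (nu (m + j)%N) (ex_intro2 _ _ (m + j)%N I erefl).
  (* The same vector [k] serves, so its vanishing at [x = 0] is inherited. *)
  exists k; split => // y /kP lb.
  set xi := x + y + _ in lb *.
  have cl f : continuous f -> (forall x, `|f x| <= 1) ->
      `|\int[nu (m + j)%N]_x f x - \int[nu' (m + j)%N]_x f x| <= eps / 4.
    have es l : \sum_(i < l) e (n (m + j) + i)%N <= eps / 4.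
      apply: le_trans (le_trans (@tail_sum_le e m (n (m + j) - m) l e0) (em _)).
      by apply: ler_sum => i _; rewrite subnKC.
    exact: (infinite_convolution_close (fun=> expM _) (fun=> B0 _) (fun=> B'0 _) es
      (cnu (m + j)%N) (cnu' (m + j)%N)).
  have := fourier_close xi cl; rewrite (_ : 2 * (eps / 4) = eps / 2); last by lra.
  move: lb; move: (fourier _ _) (fourier _ _) => F' F lb FF'.
  have -> : (eps / 2)%:C%C = eps%:C%C - (eps / 2)%:C%C :> R[i].
    by rewrite -rmorphB; congr (_%:C%C); lra.
  rewrite lerBlDr (le_trans lb)// (le_trans _ (lerD (lexx _) FF'))//.
  by have := ler_normD F' (F - F'); rewrite subrKC.
Qed.

End InfiniteConvolutions.
Theorem corollary2p3 (R : realType) (d : nat)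
  (M : nat -> 'M[int]_d) (B B' : nat -> {fset 'cV[int]_d})
  (M_expansive : forall k, expansive R (M k))
  (B_card : forall k, (2 <= #|` B k |)%N)
  (B'_card : forall k, (2 <= #|` B' k |)%N)
  (B_equiv : equivalent_seq R B B') :
  ((exists mu : probability (euclid R d) R, is_infinite_convolution M B mu) <->
   (exists mu' : probability (euclid R d) R, is_infinite_convolution M B' mu'))
  /\
  (forall mu mu' : probability (euclid R d) R,
     is_infinite_convolution M B mu -> is_infinite_convolution M B' mu' ->
     (equi_positive_measure M B mu <-> equi_positive_measure M B' mu')).
Proof.
have B0 k : B k != fset0 by rewrite -cardfs_gt0 (leq_trans _ (B_card k)).
have B'0 k : B' k != fset0 by rewrite -cardfs_gt0 (leq_trans _ (B'_card k)).
have tBB' := equivalent_seq_tails B_equiv.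
have tB'B : tails_vanish (fun k => 2 * set_distance R (B' k) (B k)).
  by under eq_fun do rewrite set_distanceC.
split; first split=> -[mu cmu].
- exact: infinite_convolution_transfer M_expansive B0 B'0 tBB' cmu.
- exact: infinite_convolution_transfer M_expansive B'0 B0 tB'B cmu.
move=> mu mu' cmu cmu'; split.
- exact: equi_positive_transfer M_expansive B0 B'0 tBB' cmu'.
- exact: equi_positive_transfer M_expansive B'0 B0 tB'B cmu.
Qed.
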